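(* Let $\mu_0,\mu_1\in RMM_d$ be written as $$\mathrm{d}\mu_j(x)=\sum_{k=1}^{K_j}\pi_j^k\,\mathrm{d}\nu_j^k(x),\qquad \nu_j^k=R_d(m_j^k,c_j^k,\rho_j),\qquad j=0,1,$$ and let $w^*$ be an $RW_2$ optimal plan between $\mu_0$ and $\mu_1$. The displacement interpolation on $(RMM_d,RW_2)$ connecting $\mu_0$ and $\mu_1$ is given by $$\mu_t=\sum_{k=1}^{K_0}\sum_{l=1}^{K_1} w^*_{kl}\,\nu_t^{kl},\qquad t\in[0,1],$$ where $\nu_t^{kl}$ is the displacement interpolation between $\nu_0^k$ and $\nu_1^l$, and $$RW_2(\mu_s,\mu_t)=(t-s)\,RW_2(\mu_0,\mu_1),\qquad 0\le s\le t\le 1 .$$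
   Context: Let $d\ge 1$ be an integer. $\mathcal{P}_2(\mathbb{R}^d)$ is the set of Borel probability measures on $\mathbb{R}^d$ with finite second moment, and $W_2$ is the Wasserstein distance on it: $W_2(\mu,\nu)^2=\inf_{\gamma}\int_{\mathbb{R}^d\times\mathbb{R}^d}\|x-y\|^2\,\mathrm{d}\gamma(x,y)$, the infimum being over probability measures $\gamma$ on $\mathbb{R}^d\times\mathbb{R}^d$ with marginals $\mu$ and $\nu$. $\Gamma_K$ denotes the probability simplex in $\mathbb{R}^K$. Radially contoured distributions: for $m\in\mathbb{R}^d$, $c>0$ and a generator $\rho$, which is either a nonnegative continuous function on $[0,\infty)$ or the Dirac $\delta$ function, $R_d(m,c,\rho)$ is the probability measure $\frac1Z\rho\left(\frac{\|x-m\|}{c}\right)\mathrm{d}x$ on $\mathbb{R}^d$, with $Z$ the normalizing constant (when $\rho$ is the Dirac $\delta$, this is the point mass at $m$). It is always assumed that these measures belong to $\mathcal{P}_2(\mathbb{R}^d)$. Radial mixtures: for a generator $\rho$, $RMM_d(\rho)$ is the set of all finite mixtures $\mu=\sum_{k=1}^K\pi^k\nu^k$ with $K\ge1$, $\pi=(\pi^1,\dots,\pi^K)\in\Gamma_K$ and $\nu^k=R_d(m^k,c^k,\rho)$. $RMM_d(\rho)$ is called identifiable if, for any two mixtures $\mu_j=\sum_{k=1}^{K_j}\pi_j^k\nu_j^k$ in $RMM_d(\rho)$ ($j=0,1$) with $\nu_j^k\ne\nu_j^l$ for all $1\le k<l\le K_j$, one has $\mu_0=\mu_1$ if and only if $K_0=K_1$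 and there is a permutation $\sigma$ of $\{1,\dots,K_0\}$ with $\pi_0^{\sigma(k)}=\pi_1^k$ and $\nu_0^{\sigma(k)}=\nu_1^k$ for all $k$. Finally $RMM_d=\bigcup_\rho RMM_d(\rho)$, the union being over all generators $\rho$ for which $RMM_d(\rho)$ is identifiable. $RW_2$ distance: for weight vectors $\pi_0\in\Gamma_{K_0}$, $\pi_1\in\Gamma_{K_1}$, $\Pi(\pi_0,\pi_1)$ is the set of nonnegative $K_0\times K_1$ matrices $w$ with $\sum_l w_{kl}=\pi_0^k$ for all $k$ and $\sum_k w_{kl}=\pi_1^l$ for all $l$. For radial mixtures $\mu_0=\sum_k\pi_0^k\nu_0^k$ and $\mu_1=\sum_l\pi_1^l\nu_1^l$, $$RW_2(\mu_0,\mu_1)^2=\min_{w\in\Pi(\pi_0,\pi_1)}\sum_{k,l}w_{kl}W_2(\nu_0^k,\nu_1^l)^2,$$ and a minimizer $w^*$ is called an $RW_2$ optimal plan between $\mu_0$ and $\mu_1$. Displacement (McCann) interpolation: if $T$ is the Monge map (optimal transport map for the cost $\|x-y\|^2$) from $\nu_0$ to $\nu_1$, the displacement interpolation between $\nu_0$ and $\nu_1$ is $\nu_t=(T_t)_\#\nu_0$ with $T_t(x)=(1-t)x+tT(x)$, $t\in[0,1]$. It is a constant speed geodesic for $W_2$. On $(RMM_d,RW_2)$, a displacement interpolation connecting $\mu_0$ and $\mu_1$ means, analogously, a constant speed geodesic path $(\mu_t)_{t\in[0,1]}$ from $\mu_0$ to $\mu_1$ with respect to $RW_2$.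
   Formalization: Identifiability is taken over mixtures with positive weights; from a point mass to a non-point mass the displacement interpolation is the reversed one; that μ_t lies in RMM_d is claimed only if ρ_0=ρ_1 or one of them is the Dirac δ, since it fails in general for two different densities. *)

(* Defs.v *)
From HB Require Import structures.
From mathcomp Require Import all_boot all_order all_algebra.
From mathcomp Require Import all_classical all_reals all_analysis.

Set Implicit Arguments.
Unset Strict Implicit.
Unset Printing Implicit Defensive.

Import Order.TTheory GRing.Theory Num.Theory.
Import numFieldNormedType.Exports.
Local Open Scope classical_set_scope.
Local Open Scope ring_scope.

(* R^d is [d.-tuple R]; the library equips it with the sigma-algebra generated
   by the coordinates, that is, the Borel sigma-algebra of R^d. *)
Section Euclidean.
Context {R : realType}.

Definition edist d (x y : d.-tuple R) : R :=
  Num.sqrt (\sum_(i < d) (tnth x i - tnth y i) ^+ 2).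

Definition origin d : d.-tuple R := [tuple 0 | _ < d].

Definition lerp d (t : R) (x y : d.-tuple R) : d.-tuple R :=
  [tuple (1 - t) * tnth x i + t * tnth y i | i < d].

(* Lebesgue measure on R^d, as an iterated product measure. *)
Fixpoint lebesgue d : set (d.-tuple R) -> \bar R :=
  match d with
  | 0 => dirac [tuple]
  | n.+1 => pushforward (lebesgue_measure \x @lebesgue n)%E
              (fun p : R * n.-tuple R => [tuple of p.1 :: p.2])
  end.

End Euclidean.

Section Measures.
Context {R : realType} {d : nat}.
Implicit Types mu nu : set (d.-tuple R) -> \bar R.

(* Measures are functions on all subsets, with unspecified values outside the
   sigma-algebra; equality of measures is equality on measurable sets. *)
Definition same_measure mu nu : Prop :=
  forall A, measurable A -> mu A = nu A.

Definition finite_second_moment mu : Prop :=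
  (\int[mu]_x (edist x (origin d) ^+ 2)%:E < +oo)%E.

End Measures.

Section Wasserstein.
Context {R : realType} {d : nat}.
Implicit Types mu nu : probability (d.-tuple R) R.

Definition coupling mu nu
    (g : probability (d.-tuple R * d.-tuple R)%type R) : Prop :=
  same_measure (pushforward g fst) mu /\ same_measure (pushforward g snd) nu.

Definition W2 mu nu : R :=
  Num.sqrt (fine (ereal_inf
    [set (\int[g]_z (edist z.1 z.2 ^+ 2)%:E)%E | g in coupling mu nu])).

(* [T] transports [mu] to [nu], and the plan (id, T)_# mu is optimal. *)
Definition monge_map mu nu (T : d.-tuple R -> d.-tuple R) : Prop :=
  [/\ measurable_fun setT T,
      same_measure (pushforward mu T) nu &
      (\int[mu]_x (edist x (T x) ^+ 2)%:E = (W2 mu nu ^+ 2)%:E)%E].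

Definition mccann mu nu (path : R -> probability (d.-tuple R) R) : Prop :=
  exists2 T, monge_map mu nu T &
    forall t, 0 <= t <= 1 ->
      same_measure (path t) (pushforward mu (fun x => lerp t x (T x))).

(* When [mu] is a point mass and [nu] is not, no map transports [mu] to [nu];
   the interpolation is then the one from [nu] to [mu], run backwards.  For
   absolutely continuous [mu] and [nu] the two alternatives define the same
   path. *)
Definition displacement_interpolation mu nu
    (path : R -> probability (d.-tuple R) R) : Prop :=
  mccann mu nu path \/ mccann nu mu (fun t => path (1 - t)).

End Wasserstein.

(* Only the values of the density profile on [0, +oo[ matter. *)
Inductive generator (R : realType) :=
  | profile of R -> R
  | dirac_delta.
Arguments dirac_delta {R}.

Section Radial.
Context {R : realType} (d : nat).
Implicit Types (rho : generator R) (m : d.-tuple R) (c : R).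

Definition radial m c rho : set (d.-tuple R) -> \bar R :=
  match rho with
  | profile f => fun A =>
      let mass B := (\int[@lebesgue R d]_(x in B) (f (edist x m / c))%:E)%E in
      (mass A * (fine (mass setT))^-1%:E)%E
  | dirac_delta => dirac m
  end.

Definition is_radial m c rho (nu : probability (d.-tuple R) R) : Prop :=
  0 < c /\ same_measure nu (radial m c rho).

(* The last clause is the standing assumption that all the radial distributions
   are in P_2(R^d); in particular it forces the normalizing constant to be
   positive and finite. *)
Definition is_generator rho : Prop :=
  (if rho is profile f then
     (forall r, 0 <= r -> 0 <= f r) /\ {within `[0, +oo[, continuous f}
   else True) /\
  forall m c, 0 < c ->
    exists2 nu, is_radial m c rho nu & finite_second_moment nu.

End Radial.

(* A mixture is kept together with its representation: [RW2] is computed from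
   the weights and the components. *)
Record mixture (R : realType) (d : nat) (I : Type) := Mixture {
  weight : I -> R ;
  component : I -> probability (d.-tuple R) R }.

Section Mixtures.
Context {R : realType} {d : nat}.

Definition simplex (I : finType) (p : I -> R) : Prop :=
  (forall i, 0 <= p i) /\ \sum_i p i = 1.

Definition mixture_measure (I : finType) (M : mixture R d I) :
    set (d.-tuple R) -> \bar R :=
  fun A => (\sum_i (weight M i)%:E * component M i A)%E.

Definition radial_mixture (I : finType) (rho : generator R)
    (M : mixture R d I) : Prop :=
  simplex (weight M) /\ forall i, exists m c, is_radial m c rho (component M i).

Definition distinct_components (I : finType) (M : mixture R d I) : Prop :=
  forall i j, i != j -> ~ same_measure (component M i) (component M j).

End Mixtures.

(* The weights are required to be positive here: since components of weight
   zero can be added to any mixture without changing the measure, no generator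
   would be identifiable otherwise. *)
Definition identifiable (R : realType) (d : nat) (rho : generator R) : Prop :=
  forall (K0 K1 : nat) (M0 : mixture R d 'I_K0) (M1 : mixture R d 'I_K1),
    radial_mixture rho M0 -> radial_mixture rho M1 ->
    (forall k, 0 < weight M0 k) -> (forall k, 0 < weight M1 k) ->
    distinct_components M0 -> distinct_components M1 ->
    same_measure (mixture_measure M0) (mixture_measure M1) <->
    K0 = K1 /\
    exists2 s : 'I_K1 -> 'I_K0, bijective s &
      forall k, weight M0 (s k) = weight M1 k /\
                same_measure (component M0 (s k)) (component M1 k).

Definition RMM (R : realType) (d : nat)
    (mu : set (d.-tuple R) -> \bar R) : Prop :=
  exists rho : generator R, [/\ is_generator d rho, identifiable d rho &
    exists (K : nat) (M : mixture R d 'I_K),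
      radial_mixture rho M /\ same_measure mu (mixture_measure M)].

Section RadialWasserstein.
Context {R : realType} {d : nat}.

Definition plan (I J : finType) (p : I -> R) (q : J -> R) (w : I -> J -> R) :
    Prop :=
  [/\ forall i j, 0 <= w i j,
      forall i, \sum_j w i j = p i &
      forall j, \sum_i w i j = q j].

Definition plan_cost (I J : finType) (M0 : mixture R d I) (M1 : mixture R d J)
    (w : I -> J -> R) : R :=
  \sum_i \sum_j w i j * W2 (component M0 i) (component M1 j) ^+ 2.

Definition RW2 (I J : finType) (M0 : mixture R d I) (M1 : mixture R d J) : R :=
  Num.sqrt (inf [set plan_cost M0 M1 w | w in plan (weight M0) (weight M1)]).

Definition optimal_plan (I J : finType) (M0 : mixture R d I)
    (M1 : mixture R d J) (w : I -> J -> R) : Prop :=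
  plan (weight M0) (weight M1) w /\
  forall w', plan (weight M0) (weight M1) w' ->
    plan_cost M0 M1 w <= plan_cost M0 M1 w'.

End RadialWasserstein.

(* Main.v *)
Require Import Defs.
From HB Require Import structures.
From mathcomp Require Import all_boot all_order all_algebra.
From mathcomp Require Import all_classical all_reals all_analysis.
From mathcomp Require Import measurable_realfun ring lra.

Set Implicit Arguments.
Unset Strict Implicit.
Unset Printing Implicit Defensive.

Import Order.TTheory GRing.Theory Num.Theory.
Import numFieldNormedType.Exports.
Local Open Scope classical_set_scope.
Local Open Scope ring_scope.

(** The lower bound in the constant speed identity is the triangle inequality
    for [RW2] along the chain [M0], [mu s], [mu t], [M1].  The plan that keeps
    the weight [w k l] on the pair [(k, l)] shows that [mu s] and [mu t] are at
    distance at most [(t - s) * RW2 M0 M1] ([RW2_interpolation_le]); the outer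
    legs of the chain thus have length at most [s] and [1 - t] times the total,
    and the middle leg has to make up for the rest.

    An arbitrary plan between [mu s] and [mu t] may move mass between
    components with different indices, so [RW2_triangle] needs the triangle
    inequality of [W2] for arbitrary couplings.  All triangle inequalities are
    proved in the quadratic form
    [C13 <= (1 + l) * C12 + (1 + l^-1) * C23] for all [l > 0],
    which is linear in the costs and therefore passes through integrals,
    infima and finite sums; [sqrt_le_sqrtD] returns to the usual form by
    optimizing over [l].  For [W2] the two couplings are glued without
    disintegration: space is cut into countably many small cells, and above
    each cell the product of the two restricted couplings is taken
    ([approximate_gluing]).  The two copies of the middle point are then in the
    same cell, which costs an error as small as one likes ([sqr_W2_young]).

    That [mu t] is again a radial mixture needs to know the Monge maps.  Two
    members of one radial family are images of each other under an affine map
    [x |-> a x + b] with [a > 0].  Completing the square, [a] times the cost of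
    a coupling is the integral of [|y - (a x + b)|^2] up to a quantity that
    depends on the marginals only; hence every Monge map equals the affine one
    almost everywhere ([monge_map_affine]), and the interpolants are affine
    images of the first measure.  When one end is a point mass, a Monge map
    from the other end is almost everywhere constant, and the interpolants are
    homothetic images of that end ([displacement_dirac]).  Radial families
    are stable under such maps because Lebesgue measure is multiplied by a
    constant ([lebesgue_affine], [is_radial_affine]). *)

Local Notation edist := Defs.edist.

(** * Squared Euclidean distances *)

Section Reals.
Context {R : realType}.
Implicit Types a b l A B C : R.

Lemma sqrD_le_young l a b : 0 < l ->
  (a + b) ^+ 2 <= (1 + l) * a ^+ 2 + (1 + l^-1) * b ^+ 2.
Proof.
move=> l0; rewrite -subr_ge0.
have -> : (1 + l) * a ^+ 2 + (1 + l^-1) * b ^+ 2 - (a + b) ^+ 2 =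
  l * (a - l^-1 * b) ^+ 2 by field; rewrite gt_eqF.
by rewrite mulr_ge0 ?sqr_ge0 ?ltW.
Qed.

(** The right-hand side is smallest at [l = sqrt (B / A)], where it equals
    [(sqrt A + sqrt B) ^+ 2]. *)
Lemma sqrt_le_sqrtD A B C : 0 <= A -> 0 <= B ->
  (forall l, 0 < l -> C <= (1 + l) * A + (1 + l^-1) * B) ->
  Num.sqrt C <= Num.sqrt A + Num.sqrt B.
Proof.
move=> A0 B0 CAB; apply/ler_addgt0Pr => e e0.
(* The margin [e] makes both square roots positive, so that [b / a] is a
   legitimate choice of [l] even if [A] or [B] vanishes. *)
pose a := Num.sqrt A + e / 2; pose b := Num.sqrt B + e / 2.
have a0 : 0 < a by rewrite ltr_wpDl ?sqrtr_ge0 ?divr_gt0.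
have b0 : 0 < b by rewrite ltr_wpDl ?sqrtr_ge0 ?divr_gt0.
have -> : Num.sqrt A + Num.sqrt B + e = a + b by rewrite /a /b; field.
have Aa : A <= a ^+ 2.
  by rewrite -{1}(sqr_sqrtr A0) lerXn2r ?nnegrE ?sqrtr_ge0 ?ltW// ltrDl divr_gt0.
have Bb : B <= b ^+ 2.
  by rewrite -{1}(sqr_sqrtr B0) lerXn2r ?nnegrE ?sqrtr_ge0 ?ltW// ltrDl divr_gt0.
have <- : Num.sqrt ((a + b) ^+ 2) = a + b.
  by rewrite sqrtr_sqr ger0_norm// addr_ge0 ?ltW.
rewrite ler_wsqrtr//.
have l0 : 0 < b / a by rewrite divr_gt0.
apply: (le_trans (CAB _ l0)).
have -> : (a + b) ^+ 2 = (1 + b / a) * a ^+ 2 + (1 + (b / a)^-1) * b ^+ 2.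
  by field; rewrite !gt_eqF.
by apply: lerD; rewrite ler_wpM2l// addr_ge0// ?invr_ge0 ltW.
Qed.

End Reals.

Section EuclideanDistance.
Context {R : realType} {n : nat}.
Implicit Types (x y z : n.-tuple R) (a : R).

Lemma sqr_edist x y : edist x y ^+ 2 = \sum_(i < n) (tnth x i - tnth y i) ^+ 2.
Proof. by rewrite sqr_sqrtr// sumr_ge0// => i _; rewrite sqr_ge0. Qed.

Lemma edist_nneg x y : 0 <= edist x y. Proof. exact: sqrtr_ge0. Qed.

Lemma edistC x y : edist x y = edist y x.
Proof. by congr Num.sqrt; apply: eq_bigr => i _; rewrite -sqrrN opprB. Qed.

Lemma sqr_edist_eq0 x y : edist x y ^+ 2 = 0 -> x = y.
Proof.
rewrite sqr_edist => /eqP.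
rewrite psumr_eq0 => [/allP h|i _]; last exact: sqr_ge0.
apply: eq_from_tnth => i; apply/eqP.
by rewrite -subr_eq0 -sqrf_eq0; apply: (implyP (h i _)).
Qed.

Lemma sqr_edist_young (l : R) x y z : 0 < l ->
  edist x z ^+ 2 <= (1 + l) * edist x y ^+ 2 + (1 + l^-1) * edist y z ^+ 2.
Proof.
move=> l0; rewrite !sqr_edist !mulr_sumr -big_split/=.
apply: ler_sum => i _.
have -> : tnth x i - tnth z i = (tnth x i - tnth y i) + (tnth y i - tnth z i).
  by ring.
exact: sqrD_le_young.
Qed.

Lemma sqr_edist_lerp s t x y :
  edist (lerp s x y) (lerp t x y) ^+ 2 = (t - s) ^+ 2 * edist x y ^+ 2.
Proof.
rewrite !sqr_edist mulr_sumr; apply: eq_bigr => i _.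
by rewrite !tnth_mktuple; ring.
Qed.

Lemma lerp0 x y : lerp 0 x y = x.
Proof. by apply: eq_from_tnth => i; rewrite tnth_mktuple; ring. Qed.

Lemma lerp1 x y : lerp 1 x y = y.
Proof. by apply: eq_from_tnth => i; rewrite tnth_mktuple; ring. Qed.

Definition affine a (b x : n.-tuple R) : n.-tuple R :=
  [tuple a * tnth x i + tnth b i | i < n].

Lemma edist_affine a (b x y : n.-tuple R) : 0 <= a ->
  edist (affine a b x) (affine a b y) = a * edist x y.
Proof.
move=> a0; transitivity (Num.sqrt (a ^+ 2) * edist x y); last first.
  by rewrite sqrtr_sqr ger0_norm.
rewrite -sqrtrM ?sqr_ge0//.
congr Num.sqrt; rewrite mulr_sumr; apply: eq_bigr => i _.
by rewrite !tnth_mktuple; ring.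
Qed.

End EuclideanDistance.

Section Measurability.
Context {R : realType} {n : nat} {disp} {T : measurableType disp}.
Implicit Types f g : T -> n.-tuple R.

Lemma measurable_tuple f :
  (forall i, measurable_fun setT (fun x => tnth (f x) i)) ->
  measurable_fun setT f.
Proof. by move=> mf; apply/measurable_fun_tnthP. Qed.

Lemma measurable_coord f i : measurable_fun setT f ->
  measurable_fun setT (fun x => tnth (f x) i).
Proof. by move=> mf; apply: (measurableT_comp (measurable_tnth i)). Qed.

Lemma measurable_sqr_edist f g :
  measurable_fun setT f -> measurable_fun setT g ->
  measurable_fun setT (fun x => edist (f x) (g x) ^+ 2).
Proof.
move=> mf mg; under eq_fun do rewrite sqr_edist.
apply: measurable_sum => i; under eq_fun do rewrite expr2.
by apply: measurable_funM; apply: measurable_funB; exact: measurable_coord.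
Qed.

Lemma measurable_lerp t f g :
  measurable_fun setT f -> measurable_fun setT g ->
  measurable_fun setT (fun x => lerp t (f x) (g x)).
Proof.
move=> mf mg; apply: measurable_tuple => i.
under eq_fun do rewrite tnth_mktuple.
by apply: measurable_funD; apply: measurable_funM => //; exact: measurable_coord.
Qed.

Lemma measurable_affine a b f : measurable_fun setT f ->
  measurable_fun setT (fun x => affine a b (f x)).
Proof.
move=> mf; apply: measurable_tuple => i.
under eq_fun do rewrite tnth_mktuple.
apply: measurable_funD => //; apply: measurable_funM => //.
exact: measurable_coord.
Qed.

End Measurability.

(** * Image measures *)

Section ImageLaw.
Context {R : realType} {d1 d2} {T1 : measurableType d1} {T2 : measurableType d2}.

Lemma measurable_preimage (f : T1 -> T2) (A : set T2) :
  measurable_fun setT f -> measurable A -> measurable (f @^-1` A).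
Proof. by move=> mf mA; rewrite -[X in measurable X]setTI; exact: mf. Qed.

Lemma image_measure (P : {measure set T1 -> \bar R}) (f : T1 -> T2) :
  measurable_fun setT f ->
  exists Q : {measure set T2 -> \bar R}, forall A, Q A = P (f @^-1` A).
Proof.
move=> mf; pose Q : {measure set T2 -> \bar R} := pushforward P f.
by exists (Q mf).
Qed.

Lemma image_probability (P : probability T1 R) (f : T1 -> T2) :
  measurable_fun setT f ->
  exists Q : probability T2 R, forall A, Q A = P (f @^-1` A).
Proof.
move=> mf.
pose F : {mfun T1 >-> T2} := HB.pack f (isMeasurableFun.Build _ _ _ _ _ mf).
by exists (distribution P F).
Qed.

Lemma ge0_integral_image (P : {measure set T1 -> \bar R})
    (Q : {measure set T2 -> \bar R}) (f : T1 -> T2) (g : T2 -> \bar R) :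
  measurable_fun setT f -> (forall A, measurable A -> Q A = P (f @^-1` A)) ->
  measurable_fun setT g -> (forall y, 0 <= g y)%E ->
  (\int[Q]_y g y = \int[P]_x g (f x))%E.
Proof.
move=> mf QP mg g0.
rewrite (eq_measure_integral (pushforward P f)) => [|A mA _]; last exact: QP.
by rewrite ge0_integral_pushforward.
Qed.

End ImageLaw.

(** * Gluing two couplings along a partition of the middle space *)

Section Gluing.
Local Open Scope ereal_scope.
Context {R : realType} {d1 d2 d3} {T1 : measurableType d1}
  {T2 : measurableType d2} {T3 : measurableType d3}.
Variables (g12 : probability (T1 * T2)%type R)
  (g23 : probability (T2 * T3)%type R) (q : T2 -> nat).
Hypothesis mq : forall n, measurable (q @^-1` [set n]).
Hypothesis marg : forall A, measurable A ->
  g12 (snd @^-1` A) = g23 (fst @^-1` A).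

Let Q12 n : set (T1 * T2) := snd @^-1` (q @^-1` [set n]).
Let Q23 n : set (T2 * T3) := fst @^-1` (q @^-1` [set n]).

Let mQ12 n : measurable (Q12 n).
Proof. exact: measurable_preimage. Qed.

Let mQ23 n : measurable (Q23 n).
Proof. exact: measurable_preimage. Qed.

Let p n : R := fine (g12 (Q12 n)).

Let pV_ge0 n : (0 <= (p n)^-1)%R. Proof. by rewrite invr_ge0 fine_ge0. Qed.

Let p12 n : g12 (Q12 n) = (p n)%:E.
Proof. by rewrite fineK// fin_num_measure. Qed.

Let p23 n : g23 (Q23 n) = (p n)%:E.
Proof. by rewrite -p12 marg. Qed.

(* For a cell of mass zero the convention [0^-1 = 0] gives the right answer. *)
Let cancel_mass n (x : \bar R) : 0 <= x -> x <= (p n)%:E ->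
  (p n)^-1%:E * (x * (p n)%:E) = x.
Proof.
case: x => [x| |]; rewrite ?lee_fin ?leye_eq// => x0 xp.
have [p0|p0] := eqVneq (p n) 0%R.
  have /eqP -> : x == 0%R by rewrite eq_le x0 -p0 xp.
  by rewrite mul0e mule0.
by rewrite -!EFinM mulrCA mulVf ?mulr1.
Qed.

(** Above each cell, the two couplings are made conditionally independent. *)
Let piece n : {measure set ((T1 * T2) * (T2 * T3)) -> \bar R} :=
  mscale (NngNum (pV_ge0 n)) (mrestr g12 (mQ12 n) \x mrestr g23 (mQ23 n)).

Let pieceE n A B : measurable A -> measurable B ->
  piece n (A `*` B) = (p n)^-1%:E * (g12 (A `&` Q12 n) * g23 (B `&` Q23 n)).
Proof.
by move=> mA mB; rewrite /piece/= /mscale/= product_measure1E.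
Qed.

Let partition_sum d (T : measurableType d) (g : probability T R)
    (f : T -> nat) A : (forall n, measurable (f @^-1` [set n])) ->
  measurable A -> \sum_(0 <= n <oo) g (A `&` f @^-1` [set n]) = g A.
Proof.
move=> mf mA.
have mAf n : measurable (A `&` f @^-1` [set n]) by exact: measurableI.
have tAf : trivIset setT (fun n => A `&` f @^-1` [set n]).
  apply/trivIsetP => i j _ _ ij.
  apply/seteqP; split=> // x [[_ /= hi] [_ /= hj]].
  by move: ij; rewrite -hi -hj eqxx.
have AU : A = \bigcup_n (A `&` f @^-1` [set n]).
  apply/seteqP; split=> [x Ax|x [n _ []]//].
  by exists (f x).
rewrite [in RHS]AU measure_semi_bigcup//.
by apply: bigcup_measurable.
Qed.

Let glue : {measure set ((T1 * T2) * (T2 * T3)) -> \bar R} := mseries piece 0.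

Let glue_fst A : measurable A -> glue (fst @^-1` A) = g12 A.
Proof.
move=> mA; rewrite -(partition_sum g12 mQ12 mA) /glue/= /mseries.
apply: eq_eseriesr => n _.
rewrite -setXT pieceE// setTI p23 cancel_mass//.
by rewrite -p12 le_measure// ?inE//; exact: measurableI.
Qed.

Let glue_snd A : measurable A -> glue (snd @^-1` A) = g23 A.
Proof.
move=> mA; rewrite -(partition_sum g23 mQ23 mA) /glue/= /mseries.
apply: eq_eseriesr => n _.
rewrite -setTX pieceE// setTI p12 [X in _ * X]muleC cancel_mass//.
by rewrite -p23 le_measure// ?inE//; exact: measurableI.
Qed.

Let glue_setT : glue setT = 1.
Proof. by rewrite -(preimage_setT fst) glue_fst// probability_setT. Qed.

Let B := [set z : (T1 * T2) * (T2 * T3) | q z.1.2 != q z.2.1].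

Let mB : measurable B.
Proof.
have -> : B = ~` \bigcup_n (Q12 n `*` Q23 n).
  apply/seteqP; split=> z; rewrite /B/=.
    move=> /negP h [n _ [/= h1 h2]]; apply: h.
    by rewrite /Q12 /Q23/= in h1 h2; rewrite h1 h2.
  move=> h; apply/negP => /eqP h1; apply: h.
  by exists (q z.1.2) => //; split=> //=.
by apply: measurableC; apply: bigcup_measurable => n _; exact: measurableX.
Qed.

Let glue_null : glue B = 0.
Proof.
rewrite /glue/= /mseries eseries0// => n _ _.
have h : B `<=` (~` Q12 n `*` setT) `|` (setT `*` ~` Q23 n).
  move=> z Bz; have [zn|zn] := eqVneq (q z.1.2) n.
    right; split=> //=; rewrite /Q23/= => h.
    by move: Bz; rewrite /B/= zn h eqxx.
  by left; split=> //=; rewrite /Q12/= => h; rewrite h eqxx in zn.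
apply/(measure_negligible mB); apply: (negligibleS h).
apply: negligibleU; apply/negligibleP.
- by apply: measurableX => //; exact: measurableC.
- have mC : measurable (~` Q12 n) by exact: measurableC.
  apply: (etrans (pieceE n mC measurableT)).
  by rewrite setICl measure0 mul0e mule0.
- by apply: measurableX => //; exact: measurableC.
- have mC : measurable (~` Q23 n) by exact: measurableC.
  apply: (etrans (pieceE n measurableT mC)).
  by rewrite setICl measure0 !mule0.
Qed.

(** A substitute for the gluing lemma that needs no disintegration: the two
    copies of the middle point agree only up to the label [q]. *)
Lemma approximate_gluing :
  exists G : probability ((T1 * T2) * (T2 * T3))%type R,
    [/\ forall A, measurable A -> g12 A = G (fst @^-1` A),
        forall A, measurable A -> g23 A = G (snd @^-1` A) &
        {ae G, forall z, q z.1.2 = q z.2.1}].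
Proof.
pose G : probability _ R :=
  HB.pack (Measure.sort glue) (Measure_isProbability.Build _ _ _ glue glue_setT).
exists G; split=> [A mA|A mA|].
- by rewrite -glue_fst.
- by rewrite -glue_snd.
- exists B; split; [exact: mB|exact: glue_null|].
  by move=> z /= h; apply/negP => /eqP.
Qed.

End Gluing.

Section Quantization.
Context {R : realType} {n : nat}.

(** The label of a point encodes its cell in a cubic grid. *)
Lemma quantization (e : R) : 0 < e -> exists2 q : n.-tuple R -> nat,
  (forall k, measurable (q @^-1` [set k])) &
  forall x y, q x = q y -> edist x y ^+ 2 <= e.
Proof.
move=> e0; pose s := Num.sqrt (e / n.+1%:R).
(* The mesh satisfies [n * s ^+ 2 <= e]; the successor keeps it positive in
   dimension zero. *)
have s0 : 0 < s by rewrite sqrtr_gt0 divr_gt0.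
pose c (x : n.-tuple R) : n.-tuple int :=
  [tuple Num.floor (tnth x i / s) | i < n].
exists (fun x => pickle (c x)) => [k|x y /(pcan_inj pickleK) cxy].
  pose t := odflt (c (origin n)) (unpickle k).
  have [kt|kt] := eqVneq (pickle t) k; last first.
    rewrite [X in measurable X](_ : _ = set0)//.
    by apply/seteqP; split=> // x /= h; move: kt; rewrite /t -h pickleK/= eqxx.
  rewrite [X in measurable X](_ : _ =
      \bigcap_(i in [set: 'I_n]) [set x | tnth x i \in
        `[(tnth t i)%:~R * s, (tnth t i + 1)%:~R * s[]).
    apply: fin_bigcap_measurable => [|i _]; first exact: finite_finset.
    exact: (measurable_preimage (measurable_tnth (T := measurableTypeR R) i)
      (measurable_itv _)).
  have cE x i : (tnth x i \in `[(tnth t i)%:~R * s, (tnth t i + 1)%:~R * s[) =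
      (tnth (c x) i == tnth t i).
    rewrite tnth_mktuple in_itv/= -ler_pdivlMr// -ltr_pdivrMr//.
    by rewrite -floor_eq.
  apply/seteqP; split=> x /=.
    move=> h i _ /=; rewrite cE.
    by rewrite -h in kt; rewrite (pcan_inj pickleK kt).
  move=> h; rewrite -kt; congr pickle; apply: eq_from_tnth => i.
  by apply/eqP; rewrite -cE; exact: h.
rewrite sqr_edist; apply: (@le_trans _ _ (\sum_(i < n) s ^+ 2)).
  apply: ler_sum => i _.
  have : tnth (c x) i = tnth (c y) i by rewrite cxy.
  rewrite !tnth_mktuple => /eqP.
  rewrite floor_eq => /andP[h1 h2].
  have /andP[h3 h4] := floor_itv (tnth y i / s).
  rewrite -real_normK ?num_real// lerXn2r ?nnegrE ?(ltW s0)//.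
  have -> : tnth x i - tnth y i = (tnth x i / s - tnth y i / s) * s.
    by rewrite -mulrBl divfK// gt_eqF.
  rewrite normrM (gtr0_norm s0) ger_pMl// ler_norml.
  by move: h2 h4; rewrite intrD => h2 h4; lra.
rewrite sumr_const card_ord sqr_sqrtr ?divr_ge0 ?(ltW e0)//.
rewrite -[e / _ *+ n]mulr_natr mulrAC ler_pdivrMr//.
apply: ler_wpM2l; first exact: ltW.
by rewrite ler_nat.
Qed.

End Quantization.

(** * The Wasserstein distance *)

Lemma ge0_integral_comb {R : realType} {disp} {T : measurableType disp}
    (P : probability T R) (f g : T -> R) (a b c : R) :
  0 <= a -> 0 <= b -> 0 <= c ->
  measurable_fun setT f -> measurable_fun setT g ->
  (forall x, 0 <= f x) -> (forall x, 0 <= g x) ->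
  (\int[P]_x (a * f x + b * g x + c)%:E =
   a%:E * \int[P]_x (f x)%:E + b%:E * \int[P]_x (g x)%:E + c%:E)%E.
Proof.
move=> a0 b0 c0 mf mg f0 g0.
have mEf : measurable_fun setT (EFin \o f) by exact/measurable_EFinP.
have mEg : measurable_fun setT (EFin \o g) by exact/measurable_EFinP.
have maf : measurable_fun setT (fun x => a%:E * (f x)%:E)%E.
  by apply/measurable_EFinP; apply: measurable_funM.
have mbg : measurable_fun setT (fun x => b%:E * (g x)%:E)%E.
  by apply/measurable_EFinP; apply: measurable_funM.
under eq_integral do rewrite !EFinD !EFinM.
rewrite ge0_integralD//; last 2 first.
- by move=> x _; rewrite -!EFinM -EFinD lee_fin addr_ge0// mulr_ge0.
- by apply: emeasurable_funD.
rewrite ge0_integralD//; last 2 first.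
- by move=> x _; rewrite -EFinM lee_fin mulr_ge0.
- by move=> x _; rewrite -EFinM lee_fin mulr_ge0.
rewrite !ge0_integralZl//; last 2 first.
- by move=> x _; rewrite lee_fin.
- by move=> x _; rewrite lee_fin.
rewrite integral_cst//; congr (_ + _)%E; rewrite -[RHS]mule1.
by congr (_ * _)%E; exact: probability_setT.
Qed.

Section Wasserstein.
Context {R : realType} {n : nat}.
Local Notation law := (probability (n.-tuple R) R).
Implicit Types mu nu : law.

Let cost (g : probability (n.-tuple R * n.-tuple R)%type R) : \bar R :=
  (\int[g]_z (edist z.1 z.2 ^+ 2)%:E)%E.

Let measurable_cost : measurable_fun setT
  (fun z : n.-tuple R * n.-tuple R => (edist z.1 z.2 ^+ 2)%:E).
Proof. by apply/measurable_EFinP; exact: measurable_sqr_edist. Qed.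

Let cost_ge0 (z : n.-tuple R * n.-tuple R) :
  (0 <= (edist z.1 z.2 ^+ 2)%:E :> \bar R)%E.
Proof. by rewrite lee_fin sqr_ge0. Qed.

Let inf_ge0 mu nu : (0 <= ereal_inf [set cost g | g in coupling mu nu])%E.
Proof.
apply: le_ereal_inf_tmp => _ [g _ <-].
by apply: integral_ge0 => z _; rewrite lee_fin sqr_ge0.
Qed.

Let sqr_W2 mu nu :
  W2 mu nu ^+ 2 = fine (ereal_inf [set cost g | g in coupling mu nu]).
Proof. by rewrite sqr_sqrtr// fine_ge0//; exact: inf_ge0. Qed.

Lemma sqr_W2_le_cost mu nu g : coupling mu nu g ->
  ((W2 mu nu ^+ 2)%:E <= \int[g]_z (edist z.1 z.2 ^+ 2)%:E)%E.
Proof.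
move=> cg; rewrite sqr_W2.
apply: (@le_trans _ _ (ereal_inf [set cost g | g in coupling mu nu])).
  have := inf_ge0 mu nu; set I := ereal_inf _.
  by case: I => [r _|_|] /=; rewrite ?lexx ?leey ?leeNy_eq.
by apply: ereal_inf_lbound; exists g.
Qed.

(** Every pair of random variables with the right laws, on any probability
    space, bounds the distance from above. *)
Lemma sqr_W2_le_image disp (T : measurableType disp) (P : probability T R)
    (S S' : T -> n.-tuple R) mu nu :
  measurable_fun setT S -> measurable_fun setT S' ->
  same_measure mu (pushforward P S) -> same_measure nu (pushforward P S') ->
  ((W2 mu nu ^+ 2)%:E <= \int[P]_x (edist (S x) (S' x) ^+ 2)%:E)%E.
Proof.
move=> mS mS' muS nuS'.
have mSS' : measurable_fun setT (fun x => (S x, S' x)) by exact: measurable_fun_pair.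
have [g gE] := image_probability P mSS'.
have cg : coupling mu nu g.
  by split=> A mA; rewrite /pushforward gE ?muS ?nuS'.
apply: (le_trans (sqr_W2_le_cost cg)).
by rewrite (ge0_integral_image mSS' (fun A _ => gE A) measurable_cost cost_ge0).
Qed.

Let coupling_swap mu nu g : coupling mu nu g ->
  exists2 g', coupling nu mu g' & cost g' = cost g.
Proof.
move=> [g1 g2].
have ms : measurable_fun setT (fun z : n.-tuple R * n.-tuple R => (z.2, z.1)).
  exact: measurable_fun_pair.
have [g' g'E] := image_probability g ms.
exists g'.
  by split=> A mA; rewrite /pushforward g'E; [exact: g2|exact: g1].
rewrite /cost (ge0_integral_image ms (fun A _ => g'E A) measurable_cost cost_ge0).
by apply: eq_integral => z _ /=; rewrite edistC.
Qed.

Lemma W2C mu nu : W2 mu nu = W2 nu mu.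
Proof.
congr (Num.sqrt (fine (ereal_inf _))); apply/seteqP; split=> _ [g cg <-].
  by have [g' cg' gg'] := coupling_swap cg; exists g'.
by have [g' cg' gg'] := coupling_swap cg; exists g'.
Qed.

Let independent_coupling mu nu : exists g, coupling mu nu g.
Proof.
pose g : {measure set (n.-tuple R * n.-tuple R) -> \bar R} := (mu \x nu)%E.
have gE A B : measurable A -> measurable B -> g (A `*` B) = (mu A * nu B)%E.
  exact: product_measure1E.
have gT : g setT = 1%E by rewrite -setXTT gE// !probability_setT mule1.
pose G : probability _ R :=
  HB.pack (Measure.sort g) (Measure_isProbability.Build _ _ _ g gT).
exists G; split=> A mA; rewrite /pushforward.
  rewrite -setXT; apply: etrans (gE _ _ mA measurableT) _.
  by rewrite probability_setT mule1.
rewrite -setTX; apply: etrans (gE _ _ measurableT mA) _.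
by rewrite probability_setT mul1e.
Qed.

Let finite_cost mu nu g : finite_second_moment mu -> finite_second_moment nu ->
  coupling mu nu g -> (cost g < +oo)%E.
Proof.
move=> fmu fnu [g1 g2].
have mo : measurable_fun setT (fun x : n.-tuple R => (edist x (origin n) ^+ 2)%:E).
  by apply/measurable_EFinP; exact: measurable_sqr_edist.
apply: (@le_lt_trans _ _ (\int[g]_z (2 * edist z.1 (origin n) ^+ 2
    + 2 * edist z.2 (origin n) ^+ 2 + 0)%:E)%E).
  apply: ge0_le_integral => //.
  - apply/measurable_EFinP; apply: measurable_funD => //.
    apply: measurable_funD; apply: measurable_funM => //;
      exact: measurable_sqr_edist.
  - move=> z _; rewrite lee_fin addr0.
    have := @sqr_edist_young _ _ 1 z.1 (origin n) z.2 ltr01.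
    by rewrite invr1 (edistC (origin n)).
have mf1 : measurable_fun setT
    (fun z : n.-tuple R * n.-tuple R => edist z.1 (origin n) ^+ 2).
  exact: measurable_sqr_edist.
have mf2 : measurable_fun setT
    (fun z : n.-tuple R * n.-tuple R => edist z.2 (origin n) ^+ 2).
  exact: measurable_sqr_edist.
rewrite ge0_integral_comb//; [|by move=> ?; exact: sqr_ge0
                               |by move=> ?; exact: sqr_ge0].
have p0 x : (0 <= (edist x (origin n) ^+ 2)%:E :> \bar R)%E.
  by rewrite lee_fin sqr_ge0.
rewrite -(ge0_integral_image measurable_fst (fun A mA => esym (g1 A mA)) mo p0).
rewrite -(ge0_integral_image measurable_snd (fun A mA => esym (g2 A mA)) mo p0).
by rewrite adde0 lte_add_pinfty// lte_mul_pinfty// ?ge0_fin_numE.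
Qed.

Lemma sqr_W2_adherent mu nu (e : R) : finite_second_moment mu ->
    finite_second_moment nu -> 0 < e ->
  exists2 g, coupling mu nu g &
    (\int[g]_z (edist z.1 z.2 ^+ 2)%:E <= (W2 mu nu ^+ 2 + e)%:E)%E.
Proof.
move=> fmu fnu e0.
have [h ch] := independent_coupling mu nu.
have fi : ereal_inf [set cost g | g in coupling mu nu] \is a fin_num.
  rewrite ge0_fin_numE//; apply: le_lt_trans (finite_cost fmu fnu ch).
  by apply: ereal_inf_lbound; exists h.
have [_ [g cg <-] gi] := lb_ereal_inf_adherent e0 fi.
by exists g => //; rewrite sqr_W2 EFinD fineK// ltW.
Qed.

End Wasserstein.

Section WassersteinTriangle.
Context {R : realType} {n : nat}.
Local Notation law := (probability (n.-tuple R) R).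

(** The triangle inequality in the form that is linear in the squared
    distances: two almost optimal couplings are glued up to a quantization of
    the middle point. *)
Lemma sqr_W2_young (mu1 mu2 mu3 : law) (l : R) : 0 < l ->
  finite_second_moment mu1 -> finite_second_moment mu2 ->
  finite_second_moment mu3 ->
  W2 mu1 mu3 ^+ 2 <= (1 + l) * W2 mu1 mu2 ^+ 2 + (1 + l^-1) * W2 mu2 mu3 ^+ 2.
Proof.
move=> l0 f1 f2 f3; set a := W2 mu1 mu2 ^+ 2; set b := W2 mu2 mu3 ^+ 2.
have b0 : 0 <= b by exact: sqr_ge0.
have lV0 : 0 < l^-1 by rewrite invr_gt0.
have key e : 0 < e -> W2 mu1 mu3 ^+ 2 <= (1 + l) * (a + e)
    + (1 + l^-1) * (1 + e) * (b + e) + (1 + l^-1) * e.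
  move=> e0.
  have eV0 : 0 < e^-1 by rewrite invr_gt0.
  have l1 : 0 <= 1 + l by rewrite addr_ge0// ltW.
  have lV1 : 0 <= 1 + l^-1 by rewrite addr_ge0// ltW.
  have e1 : 0 <= 1 + e by rewrite addr_ge0// ltW.
  have [g12 c12 g12a] := sqr_W2_adherent f1 f2 e0.
  have [g23 c23 g23b] := sqr_W2_adherent f2 f3 e0.
  (* The mesh is chosen so that the quantization error, once multiplied by the
     factor [1 + e^-1] that splits it off, is at most [e]. *)
  have d0 : 0 < e / (1 + e^-1) by rewrite divr_gt0// addr_gt0.
  have [q mq qd] := @quantization R n _ d0.
  have marg A : measurable A -> g12 (snd @^-1` A) = g23 (fst @^-1` A).
    by move=> mA; rewrite [LHS](c12.2 A mA) -[LHS](c23.1 A mA).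
  have [G [G12 G23 Gq]] := approximate_gluing mq marg.
  pose pair := (n.-tuple R * n.-tuple R)%type.
  have m1 : measurable_fun setT (fun z : pair * pair => z.1.1).
    exact: (measurableT_comp measurable_fst measurable_fst).
  have m2 : measurable_fun setT (fun z : pair * pair => z.2.2).
    exact: (measurableT_comp measurable_snd measurable_snd).
  have m3 : measurable_fun setT (fun z : pair * pair => z.1.2).
    exact: (measurableT_comp measurable_snd measurable_fst).
  have m4 : measurable_fun setT (fun z : pair * pair => z.2.1).
    exact: (measurableT_comp measurable_fst measurable_snd).
  have mu1G : same_measure mu1 (pushforward G (fun z => z.1.1)).
    move=> A mA; rewrite -c12.1//; apply: G12.
    exact: measurable_preimage.
  have mu3G : same_measure mu3 (pushforward G (fun z => z.2.2)).
    move=> A mA; rewrite -c23.2//; apply: G23.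
    exact: measurable_preimage.
  have := sqr_W2_le_image m1 m2 mu1G mu3G.
  rewrite -lee_fin => /le_trans; apply.
  apply: (@le_trans _ _ (\int[G]_z ((1 + l) * edist z.1.1 z.1.2 ^+ 2
     + (1 + l^-1) * (1 + e) * edist z.2.1 z.2.2 ^+ 2 + (1 + l^-1) * e)%:E)%E).
    apply: ae_ge0_le_integral => //.
    - by move=> z _; rewrite lee_fin sqr_ge0.
    - by apply/measurable_EFinP; exact: measurable_sqr_edist.
    - move=> z _; rewrite lee_fin; apply: addr_ge0; last exact: mulr_ge0 (ltW e0).
      by apply: addr_ge0; apply: mulr_ge0 => //; rewrite ?sqr_ge0// mulr_ge0.
    - apply/measurable_EFinP; apply: measurable_funD => //.
      apply: measurable_funD; apply: measurable_funM => //;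
        exact: measurable_sqr_edist.
    - apply: filterS Gq => z /qd qz _; rewrite lee_fin.
      apply: (le_trans (sqr_edist_young z.1.1 z.1.2 z.2.2 l0)).
      rewrite -addrA lerD2l -mulrA -mulrDr ler_wpM2l//.
      apply: (le_trans (sqr_edist_young z.1.2 z.2.1 z.2.2 eV0)).
      rewrite invrK addrC lerD2l.
      by rewrite -ler_pdivlMl ?addr_gt0// mulrC.
  rewrite ge0_integral_comb//; first last.
  - by move=> z; exact: sqr_ge0.
  - by move=> z; exact: sqr_ge0.
  - exact: measurable_sqr_edist.
  - exact: measurable_sqr_edist.
  - exact: mulr_ge0 (ltW e0).
  - exact: mulr_ge0.
  have mc : measurable_fun setT (fun z : pair => (edist z.1 z.2 ^+ 2)%:E).
    by apply/measurable_EFinP; exact: measurable_sqr_edist.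
  have c0 (z : pair) : (0 <= (edist z.1 z.2 ^+ 2)%:E :> \bar R)%E.
    by rewrite lee_fin sqr_ge0.
  rewrite -(ge0_integral_image measurable_fst G12 mc c0).
  rewrite -(ge0_integral_image measurable_snd G23 mc c0).
  rewrite !EFinD !EFinM leeD2r//; apply: leeD; apply: lee_wpmul2l => //.
  by rewrite -EFinM lee_fin mulr_ge0.
apply/ler_addgt0Pr => e e0.
(* For [t <= 1] the bound [key t] exceeds the limit by at most [t * K]. *)
pose K := (1 + l) + (1 + l^-1) * (b + 3).
have b3 : 0 < b + 3 by rewrite ltr_wpDl.
have K0 : 0 < K by rewrite addr_gt0// ?mulr_gt0// addr_gt0.
pose t := Num.min 1 (e / K).
have t0 : 0 < t by rewrite lt_min ltr01 divr_gt0.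
have t1 : t <= 1 by rewrite ge_min lexx.
have tK : t * K <= e by rewrite -ler_pdivlMr// ge_min lexx orbT.
apply: (le_trans (key _ t0)); apply: le_trans (lerD (lexx _) tK).
rewrite -subr_ge0 /K.
have -> : (1 + l) * a + (1 + l^-1) * b + t * (1 + l + (1 + l^-1) * (b + 3)) -
   ((1 + l) * (a + t) + (1 + l^-1) * (1 + t) * (b + t) + (1 + l^-1) * t) =
   (1 + l^-1) * (t * (1 - t)) by ring.
by rewrite mulr_ge0// ?mulr_ge0 ?subr_ge0// ?addr_ge0// ltW.
Qed.

End WassersteinTriangle.

(** * The distance between mixtures *)

Section RadialWasserstein.
Context {R : realType} {n : nat}.
Implicit Types (I J K : finType).

Lemma plan_cost_ge0 I J (M0 : mixture R n I) (M1 : mixture R n J) w :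
  plan (weight M0) (weight M1) w -> 0 <= plan_cost M0 M1 w.
Proof.
by case=> w0 _ _; rewrite sumr_ge0// => i _; rewrite sumr_ge0// => j _;
  rewrite mulr_ge0// sqr_ge0.
Qed.

Lemma RW2_ge0 I J (M0 : mixture R n I) (M1 : mixture R n J) : 0 <= RW2 M0 M1.
Proof. exact: sqrtr_ge0. Qed.

Let costs I J (M0 : mixture R n I) (M1 : mixture R n J) : set R :=
  [set plan_cost M0 M1 w | w in plan (weight M0) (weight M1)].

Let product_plan I J (p : I -> R) (q : J -> R) : simplex p -> simplex q ->
  plan p q (fun i j => p i * q j).
Proof.
move=> [p0 p1] [q0 q1]; split=> [i j|i|j]; first exact: mulr_ge0.
- by rewrite -mulr_sumr q1 mulr1.
- by rewrite -mulr_suml p1 mul1r.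
Qed.

Let lbound_costs I J (M0 : mixture R n I) (M1 : mixture R n J) :
  lbound (costs M0 M1) 0.
Proof. by move=> _ [w pw <-]; exact: plan_cost_ge0. Qed.

Let sqr_RW2 I J (M0 : mixture R n I) (M1 : mixture R n J) :
  simplex (weight M0) -> simplex (weight M1) ->
  RW2 M0 M1 ^+ 2 = inf (costs M0 M1).
Proof.
move=> s0 s1; rewrite sqr_sqrtr//; apply: lb_le_inf; last exact: lbound_costs.
by eexists; eexists; first exact: product_plan s0 s1.
Qed.

Lemma sqr_RW2_le_plan_cost I J (M0 : mixture R n I) (M1 : mixture R n J) w :
  simplex (weight M0) -> simplex (weight M1) ->
  plan (weight M0) (weight M1) w -> RW2 M0 M1 ^+ 2 <= plan_cost M0 M1 w.
Proof.
move=> s0 s1 pw; rewrite sqr_RW2//; apply: ge_inf; last by exists w.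
by exists 0; exact: lbound_costs.
Qed.

Lemma sqr_RW2_optimal I J (M0 : mixture R n I) (M1 : mixture R n J) w :
  simplex (weight M0) -> simplex (weight M1) ->
  optimal_plan M0 M1 w -> RW2 M0 M1 ^+ 2 = plan_cost M0 M1 w.
Proof.
move=> s0 s1 [pw ow]; apply/eqP; rewrite eq_le sqr_RW2_le_plan_cost//=.
rewrite sqr_RW2//; apply: lb_le_inf; first by exists (plan_cost M0 M1 w), w.
by move=> _ [w' pw' <-]; exact: ow.
Qed.

(** Conditional independence given the middle index; an index of weight zero
    contributes nothing, by the convention [0^-1 = 0]. *)
Let glued_plan I J K (p : I -> R) (q : J -> R) (r : K -> R)
    (w01 : I -> J -> R) (w12 : J -> K -> R) :
  plan p q w01 -> plan q r w12 ->
  [/\ plan p r (fun i k => \sum_j w01 i j * w12 j k / q j),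
     forall i j, \sum_k w01 i j * w12 j k / q j = w01 i j &
     forall j k, \sum_i w01 i j * w12 j k / q j = w12 j k].
Proof.
move=> [a0 a1 a2] [b0 b1 b2].
have q0 j : 0 <= q j by rewrite -a2 sumr_ge0.
have h1 i j : \sum_k w01 i j * w12 j k / q j = w01 i j.
  rewrite -mulr_suml -mulr_sumr b1.
  have [q0j|q0j] := eqVneq (q j) 0; last by rewrite mulfK.
  rewrite q0j mulr0 mul0r.
  have /eqP : \sum_i w01 i j = 0 by rewrite a2.
  by rewrite psumr_eq0// => /allP /(_ i); rewrite mem_index_enum => /(_ isT)/eqP ->.
have h2 j k : \sum_i w01 i j * w12 j k / q j = w12 j k.
  rewrite -!mulr_suml a2.
  have [q0j|q0j] := eqVneq (q j) 0; last by rewrite mulrAC mulfV ?mul1r.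
  rewrite q0j !mul0r.
  have /eqP : \sum_k w12 j k = 0 by rewrite b1.
  by rewrite psumr_eq0// => /allP /(_ k); rewrite mem_index_enum => /(_ isT)/eqP ->.
split=> //; split=> [i k|i|k].
- by rewrite sumr_ge0// => j _; rewrite mulr_ge0 ?mulr_ge0 ?invr_ge0.
- by rewrite exchange_big/= -a1; apply: eq_bigr.
- by rewrite exchange_big/= -b2; apply: eq_bigr.
Qed.

(** Averaging [sqr_W2_young] against the glued plan gives an inequality between
    costs of plans; [sqrt_le_sqrtD] is applied only at the end. *)
Lemma RW2_triangle I J K (M0 : mixture R n I) (M1 : mixture R n J)
    (M2 : mixture R n K) :
  simplex (weight M0) -> simplex (weight M1) -> simplex (weight M2) ->
  (forall i, finite_second_moment (component M0 i)) ->
  (forall j, finite_second_moment (component M1 j)) ->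
  (forall k, finite_second_moment (component M2 k)) ->
  RW2 M0 M2 <= RW2 M0 M1 + RW2 M1 M2.
Proof.
move=> s0 s1 s2 f0 f1 f2.
have inf_costs_ge0 I' J' (M : mixture R n I') (M' : mixture R n J') :
    simplex (weight M) -> simplex (weight M') -> 0 <= inf (costs M M').
  by move=> s s'; rewrite -sqr_RW2 ?sqr_ge0.
apply: sqrt_le_sqrtD; [exact: inf_costs_ge0|exact: inf_costs_ge0|move=> l l0].
rewrite -/(costs M0 M1) -/(costs M1 M2) -/(costs M0 M2).
have lV0 : 0 < l^-1 by rewrite invr_gt0.
have key w01 w12 : plan (weight M0) (weight M1) w01 ->
    plan (weight M1) (weight M2) w12 -> inf (costs M0 M2) <=
    (1 + l) * plan_cost M0 M1 w01 + (1 + l^-1) * plan_cost M1 M2 w12.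
  move=> p01 p12; have [p02 h01 h12] := glued_plan p01 p12.
  rewrite -sqr_RW2//; apply: (le_trans (sqr_RW2_le_plan_cost s0 s2 p02)).
  have [a0 _ _] := p01; have [b0 _ _] := p12.
  have q0 j : 0 <= weight M1 j by case: s1.
  apply: (@le_trans _ _ (\sum_i \sum_k \sum_j
     (w01 i j * w12 j k / weight M1 j) *
     ((1 + l) * W2 (component M0 i) (component M1 j) ^+ 2
      + (1 + l^-1) * W2 (component M1 j) (component M2 k) ^+ 2))).
    apply: ler_sum => i _; apply: ler_sum => k _; rewrite mulr_suml.
    apply: ler_sum => j _; rewrite ler_wpM2l//.
      by rewrite mulr_ge0 ?mulr_ge0 ?invr_ge0.
    exact: sqr_W2_young.
  under eq_bigr do under eq_bigr do under eq_bigr do rewrite mulrDr.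
  under eq_bigr do under eq_bigr do rewrite big_split/=.
  under eq_bigr do rewrite big_split/=.
  rewrite big_split/= lerD//.
    rewrite /plan_cost mulr_sumr; apply: ler_sum => i _.
    rewrite exchange_big/= mulr_sumr; apply: ler_sum => j _.
    by rewrite -mulr_suml h01 mulrCA.
  rewrite exchange_big/=; under eq_bigr do rewrite exchange_big/=.
  rewrite exchange_big/= /plan_cost mulr_sumr; apply: ler_sum => j _.
  rewrite mulr_sumr; apply: ler_sum => k _.
  by rewrite -mulr_suml h12 mulrCA.
have ne I' J' (M : mixture R n I') (M' : mixture R n J') :
    simplex (weight M) -> simplex (weight M') -> has_inf (costs M M').
  move=> s s'; split; first by eexists; eexists; first exact: product_plan s s'.
  by exists 0; exact: lbound_costs.
apply/ler_addgt0Pr => e e0.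
pose t := e / (1 + l + (1 + l^-1)).
have t0 : 0 < t by rewrite divr_gt0// !addr_gt0.
have [_ [w01 p01 <-] h01] := inf_adherent t0 (ne _ _ _ _ s0 s1).
have [_ [w12 p12 <-] h12] := inf_adherent t0 (ne _ _ _ _ s1 s2).
apply: (le_trans (key _ _ p01 p12)).
have -> : e = (1 + l) * t + (1 + l^-1) * t.
  by rewrite -mulrDl mulrC divfK// gt_eqF// !addr_gt0.
by rewrite addrACA -!mulrDr lerD// ler_pM2l ?addr_gt0// ltW.
Qed.

End RadialWasserstein.

(** * Displacement interpolations *)

Section Displacement.
Context {R : realType} {n : nat}.
Local Notation law := (probability (n.-tuple R) R).
Implicit Types (mu nu : law) (path : R -> law).

Lemma same_second_moment (mu nu : {measure set (n.-tuple R) -> \bar R}) :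
  same_measure mu nu ->
  finite_second_moment nu -> finite_second_moment mu.
Proof.
move=> mn; rewrite /finite_second_moment; apply: le_lt_trans.
by rewrite (eq_measure_integral nu)// => A mA _; exact: mn.
Qed.

Lemma mccann_start mu nu path : mccann mu nu path -> same_measure (path 0) mu.
Proof.
move=> [T _ pT] A mA; rewrite pT ?lexx ?ler01// /pushforward.
by under eq_fun do rewrite lerp0.
Qed.

Lemma mccann_end mu nu path : mccann mu nu path -> same_measure (path 1) nu.
Proof.
move=> [T [_ Tn _] pT] A mA; rewrite pT ?lexx ?ler01// -Tn// /pushforward.
by under eq_fun do rewrite lerp1.
Qed.

(** Both measures are images of [mu], which couples them. *)
Lemma sqr_W2_mccann mu nu path s t : mccann mu nu path ->
  0 <= s <= 1 -> 0 <= t <= 1 ->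
  W2 (path s) (path t) ^+ 2 <= (t - s) ^+ 2 * W2 mu nu ^+ 2.
Proof.
move=> [T [mT _ costT] pT] s01 t01; rewrite -lee_fin [leRHS]EFinM -costT.
have mid : measurable_fun [set: n.-tuple R] id by [].
have mcost : measurable_fun setT (fun x => (edist x (T x) ^+ 2)%:E).
  by apply/measurable_EFinP; exact: measurable_sqr_edist.
have := sqr_W2_le_image (measurable_lerp s mid mT) (measurable_lerp t mid mT)
  (pT s s01) (pT t t01).
under eq_integral do rewrite sqr_edist_lerp EFinM.
by rewrite ge0_integralZl// => [x _|]; rewrite lee_fin sqr_ge0.
Qed.

Lemma second_moment_mccann mu nu path t : mccann mu nu path ->
  0 <= t <= 1 -> finite_second_moment mu -> finite_second_moment (path t).
Proof.
move=> [T [mT _ costT] pT] t01 fmu; rewrite /finite_second_moment.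
have mid : measurable_fun [set: n.-tuple R] id by [].
have ml := measurable_lerp t mid mT.
have mo : measurable_fun setT (fun x : n.-tuple R => (edist x (origin n) ^+ 2)%:E).
  by apply/measurable_EFinP; exact: measurable_sqr_edist.
rewrite (ge0_integral_image ml (pT t t01) mo); last first.
  by move=> x; rewrite lee_fin sqr_ge0.
apply: (@le_lt_trans _ _ (\int[mu]_x (2 * t ^+ 2 * edist x (T x) ^+ 2
    + 2 * edist x (origin n) ^+ 2 + 0)%:E)%E).
  apply: ge0_le_integral => //.
  - by move=> x _; rewrite lee_fin sqr_ge0.
  - by apply/measurable_EFinP; exact: measurable_sqr_edist.
  - apply/measurable_EFinP; apply: measurable_funD => //.
    apply: measurable_funD; apply: measurable_funM => //;
      exact: measurable_sqr_edist.
  - move=> x _; rewrite lee_fin addr0.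
    have := @sqr_edist_young _ _ 1 (lerp t x (T x)) x (origin n) ltr01.
    have := sqr_edist_lerp t 0 x (T x); rewrite lerp0 sub0r sqrrN => ->.
    by rewrite invr1 mulrA.
rewrite ge0_integral_comb//; first last.
- by move=> ?; exact: sqr_ge0.
- by move=> ?; exact: sqr_ge0.
- exact: measurable_sqr_edist.
- exact: measurable_sqr_edist.
- by rewrite mulr_ge0// sqr_ge0.
rewrite costT adde0 lte_add_pinfty//; first by rewrite -EFinM ltry.
rewrite lte_mul_pinfty// ge0_fin_numE//.
Qed.

(** Reversing time exchanges the two alternatives of the definition, which
    reduces each of the next statements to McCann interpolations. *)
Lemma displacement_interpolation_rev mu nu path :
  displacement_interpolation mu nu path ->
  displacement_interpolation nu mu (fun t => path (1 - t)).
Proof.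
move=> [h|h]; [right|by left].
rewrite [X in mccann _ _ X](_ : _ = path)//.
by apply/funext => t; congr path; ring.
Qed.

Lemma displacement_start mu nu path : displacement_interpolation mu nu path ->
  same_measure (path 0) mu.
Proof.
by move=> [/mccann_start//|/mccann_end]; rewrite subrr.
Qed.

Lemma displacement_end mu nu path : displacement_interpolation mu nu path ->
  same_measure (path 1) nu.
Proof.
by move=> /displacement_interpolation_rev/displacement_start; rewrite subr0.
Qed.

Let rev01 (t : R) : 0 <= t <= 1 -> 0 <= 1 - t <= 1.
Proof. by move=> /andP[t0 t1]; rewrite subr_ge0 t1 lerBlDr lerDl. Qed.

Lemma sqr_W2_displacement mu nu path s t :
  displacement_interpolation mu nu path -> 0 <= s <= 1 -> 0 <= t <= 1 ->
  W2 (path s) (path t) ^+ 2 <= (t - s) ^+ 2 * W2 mu nu ^+ 2.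
Proof.
move=> [h|h] s01 t01; first exact: sqr_W2_mccann.
have := sqr_W2_mccann h (rev01 s01) (rev01 t01); rewrite !subKr (W2C nu mu).
by rewrite (_ : 1 - t - (1 - s) = - (t - s)) ?sqrrN//; ring.
Qed.

Lemma second_moment_displacement mu nu path t :
  displacement_interpolation mu nu path -> 0 <= t <= 1 ->
  finite_second_moment mu -> finite_second_moment nu ->
  finite_second_moment (path t).
Proof.
move=> [h|h] t01 fmu fnu; first exact: second_moment_mccann h t01 fmu.
by have := second_moment_mccann h (rev01 t01) fnu; rewrite subKr.
Qed.

Lemma sqr_W2_same mu nu : same_measure mu nu -> W2 mu nu ^+ 2 = 0.
Proof.
move=> mn; apply/eqP; rewrite eq_le sqr_ge0 andbT -lee_fin.
have mid : measurable_fun [set: n.-tuple R] id by [].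
apply: (le_trans (sqr_W2_le_image mid mid (P := nu) mn _)) => //.
rewrite integral0_eq// => x _; rewrite sqr_edist big1// => i _.
by rewrite subrr expr0n.
Qed.

End Displacement.

Section RefinedMixtures.
Context {R : realType} {n : nat}.
Implicit Types (I J : finType).

(** A mixture [M'] that splits every component [i] of [M] into the components
    [j] with [f j = i] is compared with [M] by sending [i] to its parts. *)
Lemma sqr_RW2_le_refinement I J (M : mixture R n I) (M' : mixture R n J)
    (f : J -> I) :
  simplex (weight M) -> simplex (weight M') ->
  (forall i, \sum_(j | f j == i) weight M' j = weight M i) ->
  RW2 M M' ^+ 2 <= \sum_j weight M' j *
                    W2 (component M (f j)) (component M' j) ^+ 2.
Proof.
move=> s s' fw.
pose v i j := if f j == i then weight M' j else 0.
have pv : plan (weight M) (weight M') v.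
  split=> [i j|i|j]; rewrite /v.
  - by case: ifP => // _; case: s'.
  - by rewrite -big_mkcond fw.
  - rewrite (bigD1 (f j))//= eqxx big1 ?addr0// => i.
    by rewrite eq_sym => /negbTE ->.
apply: (le_trans (sqr_RW2_le_plan_cost s s' pv)).
rewrite /plan_cost exchange_big/=; apply: ler_sum => j _.
rewrite (bigD1 (f j))//= /v eqxx big1 ?addr0// => i.
by rewrite eq_sym => /negbTE ->; rewrite mul0r.
Qed.

Lemma RW2C I J (M : mixture R n I) (M' : mixture R n J) : RW2 M M' = RW2 M' M.
Proof.
have sub I' J' (N : mixture R n I') (N' : mixture R n J') :
  [set plan_cost N N' w | w in plan (weight N) (weight N')] `<=`
  [set plan_cost N' N w | w in plan (weight N') (weight N)].
  move=> _ [w [w0 w1 w2] <-]; exists (fun j i => w i j) => //.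
  rewrite /plan_cost exchange_big/=; apply: eq_bigr => i _.
  by apply: eq_bigr => j _; rewrite W2C.
by congr (Num.sqrt (inf _)); apply/seteqP; split; exact: sub.
Qed.

End RefinedMixtures.

(** * The interpolating mixtures *)

Section InterpolatingMixtures.
Context {R : realType} {n : nat} (I J : finType).
Variables (M0 : mixture R n I) (M1 : mixture R n J) (w : I -> J -> R)
  (nu : I -> J -> R -> probability (n.-tuple R) R).
Hypothesis pw : plan (weight M0) (weight M1) w.
Hypothesis s0 : simplex (weight M0).
Hypothesis s1 : simplex (weight M1).
Hypothesis hnu : forall i j,
  displacement_interpolation (component M0 i) (component M1 j) (nu i j).

Let mu (t : R) : mixture R n (I * J)%type :=
  Mixture (fun ij => w ij.1 ij.2) (fun ij => nu ij.1 ij.2 t).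

Lemma sum_plan_fst i : \sum_(ij | ij.1 == i) w ij.1 ij.2 = weight M0 i.
Proof.
have [_ w1 _] := pw.
rewrite big_mkcond -(pair_bigA _ (fun i' j => if i' == i then w i' j else 0))/=.
rewrite (bigD1 i)//= eqxx w1 big1 ?addr0// => i' /negbTE ->.
by rewrite big1.
Qed.

Lemma sum_plan_snd j : \sum_(ij | ij.2 == j) w ij.1 ij.2 = weight M1 j.
Proof.
have [_ _ w2] := pw.
rewrite big_mkcond -(pair_bigA _ (fun i j' => if j' == j then w i j' else 0))/=.
rewrite exchange_big (bigD1 j)//= eqxx w2 big1 ?addr0// => j' /negbTE ->.
by rewrite big1.
Qed.

Lemma simplex_plan : simplex (fun ij : I * J => w ij.1 ij.2).
Proof.
have [w0 w1 _] := pw; have [_ p1] := s0.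
split=> [ij|]; first exact: w0.
by rewrite -(pair_bigA _ w)/= -p1; apply: eq_bigr.
Qed.

Lemma mixture_measure_start :
  same_measure (mixture_measure (mu 0)) (mixture_measure M0).
Proof.
move=> A mA; rewrite /mixture_measure/=.
have [w0 w1 _] := pw.
rewrite -(pair_bigA _ (fun i j => (w i j)%:E * nu i j 0 A)%E)/=.
apply: eq_bigr => i _; rewrite -w1 -sumEFin.
under eq_bigr do rewrite (displacement_start (hnu _ _))//.
by rewrite -ge0_sume_distrl// => j _; rewrite lee_fin.
Qed.

Lemma mixture_measure_end :
  same_measure (mixture_measure (mu 1)) (mixture_measure M1).
Proof.
move=> A mA; rewrite /mixture_measure/=.
have [w0 _ w2] := pw.
rewrite -(pair_bigA _ (fun i j => (w i j)%:E * nu i j 1 A)%E)/= exchange_big/=.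
apply: eq_bigr => j _; rewrite -w2 -sumEFin.
under eq_bigr do rewrite (displacement_end (hnu _ _))//.
by rewrite -ge0_sume_distrl// => i _; rewrite lee_fin.
Qed.

Hypothesis f0 : forall i, finite_second_moment (component M0 i).
Hypothesis f1 : forall j, finite_second_moment (component M1 j).
Hypothesis ow : optimal_plan M0 M1 w.

(** The plan that keeps each pair of indices in place is compared with [w]. *)
Lemma RW2_interpolation_le s t : 0 <= s -> s <= t -> t <= 1 ->
  RW2 (mu s) (mu t) <= (t - s) * RW2 M0 M1.
Proof.
move=> hs st ht.
have s01 : 0 <= s <= 1 by rewrite hs (le_trans st).
have t01 : 0 <= t <= 1 by rewrite ht (le_trans hs).
have [w0 _ _] := pw.
rewrite -[leLHS]ger0_norm ?RW2_ge0// -[leRHS]ger0_norm; last first.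
  by rewrite mulr_ge0 ?subr_ge0 ?RW2_ge0.
rewrite -ler_sqr ?nnegrE ?normr_ge0//.
rewrite !real_normK ?num_real// exprMn (sqr_RW2_optimal s0 s1 ow).
apply: (le_trans (@sqr_RW2_le_refinement _ _ _ _ (mu s) (mu t) id
  simplex_plan simplex_plan _)).
  by move=> ij; rewrite big_pred1_eq.
rewrite /plan_cost pair_bigA/= mulr_sumr; apply: ler_sum => ij _.
by rewrite [leRHS]mulrCA ler_wpM2l// sqr_W2_displacement.
Qed.

(** Since the legs from [0] to [s] and from [t] to [1] are at most [s] and
    [1 - t] times [RW2 M0 M1], the triangle inequality leaves at least
    [t - s] times that distance for the middle leg. *)
Lemma RW2_interpolation s t : 0 <= s -> s <= t -> t <= 1 ->
  RW2 (mu s) (mu t) = (t - s) * RW2 M0 M1.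
Proof.
move=> hs st ht; apply/eqP; rewrite eq_le RW2_interpolation_le//=.
have fmu r : 0 <= r <= 1 -> forall ij, finite_second_moment (component (mu r) ij).
  by move=> r01 ij; exact: second_moment_displacement (hnu _ _) r01 (f0 _) (f1 _).
have s01 : 0 <= s <= 1 by rewrite hs (le_trans st).
have t01 : 0 <= t <= 1 by rewrite ht (le_trans hs).
have z0 : 0 <= (0 : R) <= 1 by rewrite lexx ler01.
have z1 : 0 <= (1 : R) <= 1 by rewrite lexx ler01.
have start : RW2 M0 (mu 0) = 0.
  apply/eqP; rewrite -sqrf_eq0 eq_le sqr_ge0 andbT.
  apply: (le_trans (@sqr_RW2_le_refinement _ _ _ _ M0 (mu 0) fst
    s0 simplex_plan sum_plan_fst)).
  rewrite big1// => ij _; rewrite W2C sqr_W2_same ?mulr0//.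
  exact: displacement_start (hnu _ _).
have finish : RW2 (mu 1) M1 = 0.
  rewrite RW2C; apply/eqP; rewrite -sqrf_eq0 eq_le sqr_ge0 andbT.
  apply: (le_trans (@sqr_RW2_le_refinement _ _ _ _ M1 (mu 1) snd
    s1 simplex_plan sum_plan_snd)).
  rewrite big1// => ij _; rewrite W2C sqr_W2_same ?mulr0//.
  exact: displacement_end (hnu _ _).
have wmu r : simplex (weight (mu r)) := simplex_plan.
have t1 := RW2_triangle s0 (wmu 0) s1 f0 (fmu 0 z0) f1.
have t2 := RW2_triangle (wmu 0) (wmu s) s1 (fmu _ z0) (fmu _ s01) f1.
have t3 := RW2_triangle (wmu s) (wmu t) s1 (fmu _ s01) (fmu _ t01) f1.
have t4 := RW2_triangle (wmu t) (wmu 1) s1 (fmu _ t01) (fmu _ z1) f1.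
have u1 := RW2_interpolation_le (lexx 0) hs (le_trans st ht).
have u2 := RW2_interpolation_le (le_trans hs st) ht (lexx 1).
rewrite start in t1; rewrite finish in t4.
nra.
Qed.

End InterpolatingMixtures.

(** * Lebesgue measure under affine maps *)

Section SigmaFinite.
Context {R : realType} {disp} {T : measurableType disp}.
Variable m : {measure set T -> \bar R}.
Hypothesis sm : sigma_finite setT m.

(** A name of its own for [m], to which the structure that depends on the
    hypothesis [sm] can be attached. *)
Definition sigma_finite_copy : set T -> \bar R := m.

HB.instance Definition _ := Measure.copy sigma_finite_copy m.
HB.instance Definition _ :=
  Measure_isSigmaFinite.Build _ _ _ sigma_finite_copy sm.

Lemma sigma_finite_measureE :
  exists M : {sigma_finite_measure set T -> \bar R}, forall A, M A = m A.
Proof. by exists sigma_finite_copy. Qed.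

End SigmaFinite.

Section LebesgueAffine.
Context {R : realType}.
Local Open Scope ereal_scope.

Lemma lebesgue_measure_affine (a b : R) (A : set R) : (0 < a)%R -> measurable A ->
  lebesgue_measure A =
  a%:E * lebesgue_measure ((fun x => (a * x + b)%R) @^-1` A).
Proof.
move=> a0 mA.
have mf : measurable_fun setT (fun x : R => (a * x + b)%R).
  by apply: measurable_funD => //; exact: measurable_funM.
pose a' : {nonneg R} := NngNum (ltW a0).
have mf' : @measurable_fun _ _ (measurableTypeR R) (measurableTypeR R) setT
    (fun x : R => (a * x + b)%R) by exact: mf.
have [m' m'E] := image_measure (@lebesgue_measure R) mf'.
pose m : {measure set (measurableTypeR R) -> \bar R} := mscale a' m'.
transitivity (m A); last by rewrite /m/= /mscale/= m'E.
apply: (@lebesgue_measure_unique R m) => // _ [[u v] _ <-].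
rewrite /m/= /mscale/= m'E.
rewrite (_ : _ @^-1` _ = `]((u - b) / a)%R, ((v - b) / a)%R]%classic); last first.
  apply/seteqP; split=> x /=; rewrite !in_itv/= ltr_pdivrMr// ler_pdivlMr//
    ltrBlDr lerBrDr (mulrC x)//.
rewrite lebesgue_measure_itv [X in a%:E * X]lebesgue_measure_itv/= !lte_fin.
rewrite ltr_pM2r ?invr_gt0// ltrD2r.
case: ifPn => uv; last by rewrite mule0.
by rewrite -!EFinB -EFinM -mulrBl mulrC divfK ?gt_eqF//; congr EFin; ring.
Qed.

Let cons_tuple n (p : R * n.-tuple R) : n.+1.-tuple R := [tuple of p.1 :: p.2].

Let measurable_cons_tuple n : measurable_fun setT (@cons_tuple n).
Proof. exact: (measurable_cons measurable_fst measurable_snd). Qed.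

Let uncons_tuple n (x : n.+1.-tuple R) : R * n.-tuple R :=
  (tnth x ord0, [tuple tnth x (lift ord0 i) | i < n]).

Let measurable_uncons_tuple n : measurable_fun setT (@uncons_tuple n).
Proof.
apply: measurable_fun_pair; first exact: measurable_tnth.
apply: measurable_tuple => i; under eq_fun do rewrite tnth_mktuple.
exact: measurable_tnth.
Qed.

Let cons_tupleK n : cancel (@cons_tuple n) (@uncons_tuple n).
Proof.
move=> [x t]; rewrite /uncons_tuple /cons_tuple/= tnth0; congr (_, _).
by apply: eq_from_tnth => i; rewrite tnth_mktuple tnthS.
Qed.

(** [lebesgue] is defined as a bare set function; integration and uniqueness of
    product measures need it as a structured measure. *)
Lemma lebesgue_sigma_finite n :
  exists L : {sigma_finite_measure set (n.-tuple R) -> \bar R},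
    (L : set (n.-tuple R) -> \bar R) = @lebesgue R n.
Proof.
elim: n => [|n [L LE]].
  by exists (dirac [tuple] : {finite_measure set (0.-tuple R) -> \bar R}).
have [m mE] := image_measure (lebesgue_measure \x L)%E (@measurable_cons_tuple n).
have sm : sigma_finite setT m.
  have /sigma_finiteP[F [FT ndF Foo]] := sigma_finiteT (@lebesgue_measure R).
  have /sigma_finiteP[G [GT ndG Goo]] := sigma_finiteT L.
  exists (fun k => @uncons_tuple n @^-1` (F k `*` G k)).
    apply/seteqP; split=> // x _.
    have [i _ Fi] : (\bigcup_i F i) (uncons_tuple x).1 by rewrite -FT.
    have [j _ Gj] : (\bigcup_j G j) (uncons_tuple x).2 by rewrite -GT.
    exists (maxn i j) => //; split.
    - by move: Fi; exact/subsetPset/ndF/leq_maxl.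
    - by move: Gj; exact/subsetPset/ndG/leq_maxr.
  move=> k; have [mF Fk] := Foo k; have [mG Gk] := Goo k.
  have mFG : measurable (F k `*` G k) by exact: measurableX.
  split; first exact: (measurable_preimage (@measurable_uncons_tuple n)).
  rewrite mE -comp_preimage (_ : _ \o _ = id); last first.
    by apply/funext => x; exact: cons_tupleK.
  have FGE : (lebesgue_measure \x L) (F k `*` G k) =
      lebesgue_measure (F k) * L (G k).
    exact: product_measure1E.
  suff : lebesgue_measure (F k) * L (G k) < +oo by rewrite -FGE.
  by rewrite lte_mul_pinfty// ge0_fin_numE.
have [M ME] := sigma_finite_measureE sm.
by exists M; apply/funext => A; rewrite ME /= -LE mE.
Qed.

Let affine_cons n a (b : n.+1.-tuple R) (p : R * n.-tuple R) :
  affine a b (cons_tuple p) = cons_tuple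
    ((a * p.1 + (uncons_tuple b).1)%R, affine a (uncons_tuple b).2 p.2).
Proof.
apply: eq_from_tnth => i; rewrite tnth_mktuple.
case: (unliftP ord0 i) => [j|] ->; last by rewrite !tnth0.
by rewrite !tnthS !tnth_mktuple.
Qed.

(** By uniqueness of product measures it is enough to look at boxes, that is,
    at one coordinate and, by induction, at the others. *)
Lemma lebesgue_affine n (a : R) (b : n.-tuple R) A : (0 < a)%R -> measurable A ->
  @lebesgue R n A = (a ^+ n)%:E * @lebesgue R n (affine a b @^-1` A).
Proof.
move=> a0; elim: n b A => [|n IH] b A mA.
  rewrite expr0 mul1e (_ : affine a b @^-1` A = A)//.
  by apply/funext => x; rewrite /preimage/= [affine _ _ _]tuple0 [x]tuple0.
have [L LE] := lebesgue_sigma_finite n.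
set b' := uncons_tuple b.
have mf : measurable_fun [set: R] (fun x : R => (a * x + b'.1)%R).
  by apply: measurable_funD => //; exact: measurable_funM.
have mf' : @measurable_fun _ _ (measurableTypeR R) (measurableTypeR R) setT
  (fun x : R => (a * x + b'.1)%R) by exact: mf.
pose phi (p : measurableTypeR R * n.-tuple R) : measurableTypeR R * n.-tuple R :=
  ((a * p.1 + b'.1)%R, affine a b'.2 p.2).
have mphi : measurable_fun setT phi.
  apply: measurable_fun_pair; first exact: (measurableT_comp mf' measurable_fst).
  exact: measurable_affine.
pose P : {measure set (measurableTypeR R * n.-tuple R)%type -> \bar R} :=
  (lebesgue_measure \x L)%E.
have [Q QE] := image_measure P mphi.
pose k : {nonneg R} := NngNum (ltW (exprn_gt0 n.+1 a0)).
pose m : {measure set (measurableTypeR R * n.-tuple R)%type -> \bar R} := mscale k Q.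
have Pm B : measurable B -> P B = m B.
  apply: product_measure_unique => B1 B2 mB1 mB2.
  rewrite /m/= /mscale/= QE.
  have -> : phi @^-1` (B1 `*` B2) =
    ((fun x => (a * x + b'.1)%R) @^-1` B1) `*` (affine a b'.2 @^-1` B2) by [].
  rewrite (_ : P _ = lebesgue_measure ((fun x => (a * x + b'.1)%R) @^-1` B1) *
      L (affine a b'.2 @^-1` B2)); last first.
    apply: product_measure1E; first exact: (measurable_preimage mf').
    exact: (measurable_preimage (measurable_affine a b'.2 _)).
  rewrite [in RHS](lebesgue_measure_affine b'.1 a0 mB1) LE (IH b'.2 _ mB2) -LE.
  rewrite exprS EFinM !muleA; congr (_ * _).
  by rewrite -!muleA; congr (_ * _); rewrite muleC.
rewrite /= -LE.
transitivity (P (@cons_tuple n @^-1` A)); first by [].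
rewrite Pm; last exact: (measurable_preimage (@measurable_cons_tuple n)).
rewrite /m/= /mscale/= QE; congr (_ * _); congr (P _).
by apply/funext => p; rewrite /preimage/= -/(cons_tuple p) affine_cons.
Qed.

End LebesgueAffine.

(** * Radial families *)

Section Radial.
Context {R : realType} {n : nat}.
Implicit Types (m b : n.-tuple R) (c a : R) (f : R -> R).

Let mass f m c (B : set (n.-tuple R)) : \bar R :=
  (\int[@lebesgue R n]_(x in B) (f (edist x m / c))%:E)%E.

Let measurable_density f m c : 0 < c -> {within `[0, +oo[, continuous f} ->
  measurable_fun setT (fun x : n.-tuple R => (f (edist x m / c))%:E).
Proof.
move=> c0 cf; apply/measurable_EFinP.
have mf : measurable_fun (`[0, +oo[ : set R) f.
  exact: subspace_continuous_measurable_fun.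
have m0y : measurable (`[0, +oo[ : set R) by [].
apply: (measurable_comp m0y _ mf) => //.
  move=> _ [x _ <-] /=; rewrite in_itv/= andbT.
  exact: divr_ge0 (edist_nneg _ _) (ltW c0).
apply: measurable_funM => //.
rewrite (_ : (fun x => _) = Num.sqrt \o (fun x => edist x m ^+ 2)); last first.
  by apply/funext => x /=; rewrite sqrtr_sqr ger0_norm ?edist_nneg.
apply: measurableT_comp; last exact: measurable_sqr_edist.
by apply: continuous_measurable_fun; exact: sqrt_continuous.
Qed.

Let mass_affine f m c a b B : (forall r, 0 <= r -> 0 <= f r) ->
  {within `[0, +oo[, continuous f} -> 0 < c -> 0 < a -> measurable B ->
  mass f (affine a b m) (a * c) B =
  ((a ^+ n)%:E * mass f m c (affine a b @^-1` B))%E.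
Proof.
move=> f0 cf c0 a0 mB; rewrite /mass.
have [L LE] := @lebesgue_sigma_finite R n.
have ac0 : 0 < a * c by rewrite mulr_gt0.
have maff : measurable_fun setT (affine a b) by exact: measurable_affine.
have [Q QE] := image_measure L maff.
pose k : {nonneg R} := NngNum (ltW (exprn_gt0 n a0)).
rewrite -LE (eq_measure_integral (mscale k Q)); last first.
  by move=> A mA _; rewrite /= LE (lebesgue_affine b a0 mA) /= /mscale/= QE -LE.
have dens0 m' c' x : 0 < c' -> (0 <= (f (edist x m' / c'))%:E :> \bar R)%E.
  move=> c'0; rewrite lee_fin; apply: f0.
  exact: divr_ge0 (edist_nneg _ _) (ltW c'0).
have md := measurable_density (affine a b m) ac0 cf.
rewrite ge0_integral_mscale//; [|exact: measurable_funTS|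
  by move=> x _; exact: dens0].
congr (_ * _)%E.
rewrite (eq_measure_integral (pushforward L (affine a b))); last first.
  by move=> A mA _; rewrite QE.
rewrite ge0_integral_pushforward//; [|exact: measurable_funTS|
  by move=> x _; exact: dens0].
apply: eq_integral => x _ /=; rewrite edist_affine ?ltW//.
by rewrite -mulf_div divff ?mul1r ?gt_eqF.
Qed.

(** The density of the image is again a function of the distance to the image
    of the centre, and the Jacobian cancels in the normalization. *)
Lemma is_radial_affine m c (rho : generator R)
    (nu nu' : probability (n.-tuple R) R) a b :
  is_generator n rho -> is_radial m c rho nu -> 0 < a ->
  same_measure nu' (pushforward nu (affine a b)) ->
  is_radial (affine a b m) (a * c) rho nu'.
Proof.
move=> grho [c0 nuE] a0 nu'E; split; first exact: mulr_gt0.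
move=> A mA; rewrite nu'E// /pushforward.
have maff : measurable_fun setT (affine a b) by exact: measurable_affine.
have mpre B : measurable B -> measurable (affine a b @^-1` B).
  exact: measurable_preimage.
rewrite nuE; last exact: mpre.
case: rho grho nuE => [f [[f0 cf] _] nuE|//].
rewrite /= -!/(mass _ _ _ _) !mass_affine// preimage_setT.
(* Were the total mass infinite, [fine] would make the constant [0^-1 = 0] and
   [nu] would vanish. *)
have massT : mass f m c setT \is a fin_num.
  have := nuE _ measurableT; rewrite probability_setT /= -/(mass f m c setT).
  case: (mass f m c setT) => [r|/=|/=]; rewrite ?fin_numE//= invr0 ?mule0 ?mulr0.
    by move=> /eqP; rewrite onee_eq0.
  by move=> /eqP; rewrite onee_eq0.
have an0 : a ^+ n != 0 by rewrite expf_neq0// gt_eqF.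
rewrite fineM// invfM EFinM muleACA -EFinM divff// mul1e.
by [].
Qed.

End Radial.

(** * Monge maps between affine images *)

Section AlmostEverywhere.
Context {R : realType} {n : nat} {disp} {T : measurableType disp}.
Variable P : probability T R.

Lemma ae_preimage (f g : T -> n.-tuple R) (A : set (n.-tuple R)) :
  measurable_fun setT f -> measurable_fun setT g -> measurable A ->
  {ae P, forall x, f x = g x} -> P (f @^-1` A) = P (g @^-1` A).
Proof.
move=> mf mg mA fg.
have mfA : measurable (f @^-1` A) by exact: measurable_preimage.
have mgA : measurable (g @^-1` A) by exact: measurable_preimage.
rewrite -[f @^-1` A]setIT -[g @^-1` A]setIT -!integral_indic//.
apply: ge0_ae_eq_integral => //.
- by apply/measurable_EFinP.
- by apply/measurable_EFinP.
- apply: filterS fg => x fgx _; rewrite !indicE.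
  rewrite (_ : (x \in _) = (x \in g @^-1` A))//.
  by apply/idP/idP; rewrite !inE /preimage/= fgx.
Qed.

Lemma ae_eq_sqr_edist (f g : T -> n.-tuple R) :
  measurable_fun setT f -> measurable_fun setT g ->
  (\int[P]_x (edist (f x) (g x) ^+ 2)%:E = 0)%E ->
  {ae P, forall x, f x = g x}.
Proof.
move=> mf mg fg0.
have mfg : measurable_fun setT (fun x => (edist (f x) (g x) ^+ 2)%:E).
  by apply/measurable_EFinP; exact: measurable_sqr_edist.
have : (\int[P]_x `|(edist (f x) (g x) ^+ 2)%:E| = 0)%E.
  rewrite -[RHS]fg0; apply: eq_integral => x _.
  by rewrite gee0_abs// lee_fin sqr_ge0.
move=> /(ae_eq_integral_abs P measurableT mfg); apply: filterS => x /(_ I) [] /eqP.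
by move=> /eqP /sqr_edist_eq0.
Qed.

End AlmostEverywhere.

Section AffineMongeMap.
Context {R : realType} {n : nat}.
Local Notation law := (probability (n.-tuple R) R).
Variables (mu nu : law) (a : R) (b : n.-tuple R).
Hypotheses (a0 : 0 < a) (fmu : finite_second_moment mu)
  (fnu : finite_second_moment nu)
  (affine_nu : same_measure nu (pushforward mu (affine a b))).
Local Notation o := (origin n).

(* The terms of [completed_square] below that depend on one variable only,
   moved to the side where they are nonnegative: their integrals can then be
   added without any integrability condition. *)
Let H (x : n.-tuple R) : R := a * edist x o ^+ 2 + edist (affine a o x) b ^+ 2.
Let G (y : n.-tuple R) : R := a * edist y o ^+ 2 + edist (affine 1 b y) o ^+ 2.
Let H' (x : n.-tuple R) : R := 2 * a ^+ 2 * edist x o ^+ 2 + 3 * edist b o ^+ 2.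
Let G' (y : n.-tuple R) : R := 2 * edist y o ^+ 2.

(** Completing the square: up to functions of [x] alone and of [y] alone, the
    cost is the squared distance from [y] to the affine image of [x]. *)
Let completed_square x y :
  a * edist x y ^+ 2 + (H' x + G' y) =
  edist y (affine a b x) ^+ 2 + (H x + G y).
Proof.
rewrite /H /G /H' /G' !sqr_edist !mulr_sumr -!big_split/=.
by apply: eq_bigr => i _; rewrite !tnth_mktuple; ring.
Qed.

Let measurable_quadratic : [/\ measurable_fun setT H, measurable_fun setT G,
  measurable_fun setT H' & measurable_fun setT G'].
Proof.
have mo : measurable_fun setT (fun x : n.-tuple R => edist x o ^+ 2).
  exact: measurable_sqr_edist.
have ma c v p :
    measurable_fun setT (fun x : n.-tuple R => edist (affine c v x) p ^+ 2).
  by apply: measurable_sqr_edist => //; exact: measurable_affine.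
have mM c : measurable_fun setT (fun x : n.-tuple R => c * edist x o ^+ 2).
  exact: measurable_funM.
by split; last exact: mM; apply: measurable_funD.
Qed.

Let quadratic_ge0 : [/\ forall x, 0 <= H x, forall x, 0 <= G x,
  forall x, 0 <= H' x & forall x, 0 <= G' x].
Proof.
have a0' := ltW a0.
split=> x.
- exact: addr_ge0 (mulr_ge0 a0' (sqr_ge0 _)) (sqr_ge0 _).
- exact: addr_ge0 (mulr_ge0 a0' (sqr_ge0 _)) (sqr_ge0 _).
- exact: addr_ge0 (mulr_ge0 (mulr_ge0 (ler0n _ 2) (sqr_ge0 _)) (sqr_ge0 _))
    (mulr_ge0 (ler0n _ 3) (sqr_ge0 _)).
- exact: mulr_ge0 (ler0n _ 2) (sqr_ge0 _).
Qed.

Let integral_marginals (u v : n.-tuple R -> R) S :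
  measurable_fun setT u -> measurable_fun setT v ->
  (forall x, 0 <= u x) -> (forall x, 0 <= v x) ->
  measurable_fun setT S -> same_measure nu (pushforward mu S) ->
  (\int[mu]_x (u x + v (S x))%:E =
   \int[mu]_x (u x)%:E + \int[nu]_x (v x)%:E)%E.
Proof.
move=> mu_ mv u0 v0 mS nuS.
have mEv : measurable_fun setT (fun x => (v x)%:E) by exact/measurable_EFinP.
have v0' x : (0 <= (v x)%:E :> \bar R)%E by rewrite lee_fin.
rewrite (ge0_integral_image mS nuS mEv v0').
rewrite -ge0_integralD//.
- by move=> x _; rewrite lee_fin.
- exact/measurable_EFinP.
- by apply/measurable_EFinP; exact: (measurableT_comp mv mS).
Qed.

Let integral_square S : measurable_fun setT S ->
  same_measure nu (pushforward mu S) ->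
  (a%:E * \int[mu]_x (edist x (S x) ^+ 2)%:E
    + (\int[mu]_x (H' x)%:E + \int[nu]_y (G' y)%:E) =
   \int[mu]_x (edist (S x) (affine a b x) ^+ 2)%:E
    + (\int[mu]_x (H x)%:E + \int[nu]_y (G y)%:E))%E.
Proof.
move=> mS nuS; have [mH mG mH' mG'] := measurable_quadratic.
have [H0 G0 H'0 G'0] := quadratic_ge0.
have maff : measurable_fun setT (affine a b) by exact: measurable_affine.
have comb (k : R) (f h : n.-tuple R -> R) : 0 <= k -> measurable_fun setT f ->
    measurable_fun setT h -> (forall x, 0 <= f x) -> (forall x, 0 <= h x) ->
    (\int[mu]_x (k * f x + h x)%:E =
     k%:E * \int[mu]_x (f x)%:E + \int[mu]_x (h x)%:E)%E.
  move=> k0 mf mh f0 h0.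
  have := ge0_integral_comb mu k0 ler01 (lexx 0) mf mh f0 h0.
  rewrite mul1e adde0 => <-; apply: eq_integral => x _.
  by rewrite mul1r addr0.
rewrite -!(integral_marginals _ _ _ _ mS nuS)//.
rewrite -comb//; [|exact: ltW|exact: measurable_sqr_edist| | |]; first last.
- by move=> x; rewrite addr_ge0.
- by move=> x; exact: sqr_ge0.
- by apply: measurable_funD => //; exact: (measurableT_comp mG' mS).
rewrite -[X in (X + _)%E]mul1e -comb//; first last.
- by move=> x; rewrite addr_ge0.
- by move=> x; exact: sqr_ge0.
- by apply: measurable_funD => //; exact: (measurableT_comp mG mS).
- exact: measurable_sqr_edist.
by apply: eq_integral => x _; rewrite completed_square mul1r.
Qed.

Let finite_quadratic (m : law) (h : n.-tuple R -> R) (A B : R) :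
  finite_second_moment m -> measurable_fun setT h -> (forall x, 0 <= h x) ->
  0 <= A -> 0 <= B -> (forall x, h x <= A * edist x o ^+ 2 + B) ->
  (\int[m]_x (h x)%:E < +oo)%E.
Proof.
move=> fm mh h0 A0 B0 hAB.
have mo : measurable_fun setT (fun x : n.-tuple R => edist x o ^+ 2).
  exact: measurable_sqr_edist.
apply: (@le_lt_trans _ _
  (\int[m]_x (A * edist x o ^+ 2 + 0 * edist x o ^+ 2 + B)%:E)%E).
  apply: ge0_le_integral => //.
  - by move=> x _; rewrite lee_fin.
  - exact/measurable_EFinP.
  - apply/measurable_EFinP; apply: measurable_funD => //.
    by apply: measurable_funD; exact: measurable_funM.
  - by move=> x _; rewrite lee_fin mul0r addr0.
rewrite ge0_integral_comb//; first last.
- by move=> x; exact: sqr_ge0.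
- by move=> x; exact: sqr_ge0.
rewrite mul0e adde0 lte_add_pinfty ?ltry// lte_mul_pinfty//.
Qed.

(* Needed to cancel this sum from both sides of [integral_square]. *)
Let finite_bound : (\int[mu]_x (H x)%:E + \int[nu]_y (G y)%:E < +oo)%E.
Proof.
have [mH mG _ _] := measurable_quadratic; have [H0 G0 _ _] := quadratic_ge0.
have oE : affine a o o = o.
  by apply: eq_from_tnth => i; rewrite !tnth_mktuple mulr0 addr0.
have bE : affine 1 b o = b.
  by apply: eq_from_tnth => i; rewrite !tnth_mktuple mulr0 add0r.
apply: lte_add_pinfty.
  apply: (@finite_quadratic _ _ (a + 2 * a ^+ 2) (2 * edist b o ^+ 2)) => //.
  - by rewrite addr_ge0 ?mulr_ge0 ?sqr_ge0 ?(ltW a0).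
  - by rewrite mulr_ge0 ?sqr_ge0.
  - move=> x; have := @sqr_edist_young _ _ 1 (affine a o x) o b ltr01.
    have := edist_affine o x o (ltW a0); rewrite oE => ->.
    by rewrite invr1 (edistC o b) /H exprMn; lra.
apply: (@finite_quadratic _ _ (a + 2) (2 * edist b o ^+ 2)) => //.
- by rewrite addr_ge0 ?(ltW a0).
- by rewrite mulr_ge0 ?sqr_ge0.
- move=> x; have := @sqr_edist_young _ _ 1 (affine 1 b x) b o ltr01.
  have := edist_affine b x o ler01; rewrite bE mul1r => ->.
  by rewrite invr1 /G; lra.
Qed.

(** The affine map makes the integrated square vanish, and a Monge map costs no
    more, so its square vanishes as well. *)
Lemma monge_map_affine (T : n.-tuple R -> n.-tuple R) :
  monge_map mu nu T -> {ae mu, forall x, T x = affine a b x}.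
Proof.
move=> [mT Tnu costT].
have maff : measurable_fun setT (affine a b) by exact: measurable_affine.
have nuT : same_measure nu (pushforward mu T) by move=> A mA; rewrite Tnu.
apply: ae_eq_sqr_edist => //.
have eT := integral_square mT nuT.
have eS := integral_square maff affine_nu.
have mid : measurable_fun [set: n.-tuple R] id by [].
have costS : (\int[mu]_x (edist x (T x) ^+ 2)%:E <=
    \int[mu]_x (edist x (affine a b x) ^+ 2)%:E)%E.
  by rewrite costT; apply: sqr_W2_le_image.
have e0 : (\int[mu]_x (edist (affine a b x) (affine a b x) ^+ 2)%:E = 0)%E.
  rewrite integral0_eq// => x _; rewrite sqr_edist big1// => i _.
  by rewrite subrr expr0n.
rewrite e0 add0e in eS.
set K := (\int[mu]_x (H x)%:E + _)%E in eT eS.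
have Kfin : K \is a fin_num.
  rewrite ge0_fin_numE; first exact: finite_bound.
  have [H0 G0 _ _] := quadratic_ge0.
  by apply: adde_ge0; apply: integral_ge0 => x _; rewrite lee_fin.
apply/eqP; rewrite eq_le; apply/andP; split; last first.
  by apply: integral_ge0 => x _; rewrite lee_fin sqr_ge0.
rewrite -(leeD2rE _ _ Kfin) add0e -eT -[leRHS]eS leeD2r//.
by rewrite lee_wpmul2l// lee_fin ltW.
Qed.

End AffineMongeMap.

(** * Radiality of the interpolants *)

Section RadialInterpolation.
Context {R : realType} {n : nat}.
Local Notation law := (probability (n.-tuple R) R).
Local Notation o := (origin n).
Implicit Types (mu nu : law) (path : R -> law) (m b : n.-tuple R).

Lemma is_radial_same m c rho mu nu : same_measure mu nu ->
  is_radial m c rho nu -> is_radial m c rho mu.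
Proof. by move=> mn [c0 nuE]; split=> // A mA; rewrite mn ?nuE. Qed.

Lemma radial_second_moment m c (rho : generator R) mu :
  is_generator n rho -> is_radial m c rho mu -> finite_second_moment mu.
Proof.
move=> [_ gen] [c0 muE]; have [nu [_ nuE] fnu] := gen m c c0.
apply: same_second_moment fnu => A mA.
exact: etrans (muE A mA) (esym (nuE A mA)).
Qed.

Lemma lerp_affine t a b x :
  lerp t x (affine a b x) = affine (1 - t + t * a) (affine t o b) x.
Proof. by apply: eq_from_tnth => i; rewrite !tnth_mktuple; ring. Qed.

Lemma lerp_cst t m x : lerp t m x = affine t (affine (1 - t) o m) x.
Proof. by apply: eq_from_tnth => i; rewrite !tnth_mktuple; ring. Qed.

Lemma lerp_rev t (x y : n.-tuple R) : lerp (1 - t) x y = lerp t y x.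
Proof. by apply: eq_from_tnth => i; rewrite !tnth_mktuple; ring. Qed.

Let mccann_radial m0 m1 c0 c1 (rho : generator R) mu nu path t :
  is_generator n rho -> is_radial m0 c0 rho mu -> is_radial m1 c1 rho nu ->
  mccann mu nu path -> 0 <= t <= 1 -> exists m c, is_radial m c rho (path t).
Proof.
move=> grho rmu rnu [T mongeT pT] t01.
have [mT _ _] := mongeT.
have c0gt0 := rmu.1; have c1gt0 := rnu.1.
pose a := c1 / c0; have a0 : 0 < a by exact: divr_gt0.
pose b : n.-tuple R := [tuple tnth m1 i - a * tnth m0 i | i < n].
have ac : a * c0 = c1 by rewrite divfK// gt_eqF.
have bm : affine a b m0 = m1.
  by apply: eq_from_tnth => i; rewrite !tnth_mktuple; ring.
have maff : measurable_fun setT (affine a b) by exact: measurable_affine.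
have [nu' nu'E] := image_probability mu maff.
have rnu' : is_radial m1 c1 rho nu'.
  rewrite -bm -ac; apply: (is_radial_affine grho rmu a0) => A _; exact: nu'E.
have nuS : same_measure nu (pushforward mu (affine a b)).
  by move=> A mA; rewrite rnu.2// -rnu'.2// nu'E.
have TS := monge_map_affine a0 (radial_second_moment grho rmu)
  (radial_second_moment grho rnu) nuS mongeT.
have [t0 t1] := andP t01.
have s0 : 0 < 1 - t + t * a.
  have [t_lt1|t_ge1] := ltP t 1.
    by apply: ltr_pwDl; rewrite ?subr_gt0// mulr_ge0// ltW.
  by rewrite (le_anti (introT andP (conj t1 t_ge1))) subrr add0r mul1r.
exists (affine (1 - t + t * a) (affine t o b) m0), ((1 - t + t * a) * c0).
apply: (is_radial_affine grho rmu s0) => A mA; rewrite pT// /pushforward.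
apply: ae_preimage => //.
- by apply: measurable_lerp.
- exact: measurable_affine.
- by apply: filterS TS => x ->; rewrite lerp_affine.
Qed.

Lemma displacement_radial m0 m1 c0 c1 (rho : generator R) mu nu path t :
  is_generator n rho -> is_radial m0 c0 rho mu -> is_radial m1 c1 rho nu ->
  displacement_interpolation mu nu path -> 0 <= t <= 1 ->
  exists m c, is_radial m c rho (path t).
Proof.
move=> grho rmu rnu [h|h] t01; first exact: mccann_radial grho rmu rnu h t01.
have t01' : 0 <= 1 - t <= 1 by have [? ?] := andP t01; apply/andP; split; lra.
by have := mccann_radial grho rnu rmu h t01'; rewrite subKr.
Qed.

(** If the Monge map starts from the point mass, then [nu] is a point mass too;
    if it ends there, it is almost everywhere constant.  Either way the path
    is the homothetic image of [nu] that tends to [m0] as [t] tends to [0]. *)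
Lemma displacement_dirac m0 mu nu path t :
  same_measure mu (dirac m0) -> displacement_interpolation mu nu path ->
  0 <= t <= 1 -> same_measure (path t) (pushforward nu (lerp t m0)).
Proof.
move=> mu0 h t01 A mA.
have mid : measurable_fun [set: n.-tuple R] id by [].
have mcst : measurable_fun [set: n.-tuple R] (cst m0) by [].
have ml : measurable_fun setT (lerp t m0) by exact: measurable_lerp.
case: h => [[T [mT Tnu _] pT]|[T [mT Tmu _] pT]].
  have mlT : measurable_fun setT (fun x => lerp t x (T x)) by exact: measurable_lerp.
  rewrite pT// /pushforward -(Tnu _ (measurable_preimage ml mA)) /pushforward.
  rewrite !mu0; [|exact: (measurable_preimage mT (measurable_preimage ml mA))|
                  exact: (measurable_preimage mlT mA)].
  rewrite !diracE; suff -> : (m0 \in (fun x => lerp t x (T x)) @^-1` A) =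
    (m0 \in T @^-1` (lerp t m0 @^-1` A)) by [].
  by apply/idP/idP; rewrite !inE.
have t01' : 0 <= 1 - t <= 1 by have [? ?] := andP t01; apply/andP; split; lra.
have := pT _ t01' A mA; rewrite subKr => ->; rewrite /pushforward.
apply: ae_preimage => //; first exact: measurable_lerp.
have muT : same_measure mu (pushforward nu T) by move=> B mB; rewrite Tmu.
have mE : measurable_fun setT (fun x : n.-tuple R => (edist x m0 ^+ 2)%:E).
  by apply/measurable_EFinP; exact: measurable_sqr_edist.
have E0 x : (0 <= (edist x m0 ^+ 2)%:E :> \bar R)%E by rewrite lee_fin sqr_ge0.
have Tm0 : {ae nu, forall x, T x = cst m0 x}.
  apply: ae_eq_sqr_edist => //.
  rewrite -(ge0_integral_image mT muT mE E0).
  rewrite (eq_measure_integral (dirac m0)); last first.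
    by move=> B mB _; exact: mu0.
  rewrite integral_dirac// diracT mul1e sqr_edist big1// => i _.
  by rewrite subrr expr0n.
by apply: filterS Tm0 => x ->; rewrite /= lerp_rev.
Qed.

(** At [t = 0] the interpolant is the point mass, outside the family of a
    profile [rho]. *)
Lemma displacement_dirac_radial m0 c0 m1 c1 (rho : generator R) mu nu path t :
  is_generator n rho -> is_radial m0 c0 dirac_delta mu ->
  is_radial m1 c1 rho nu -> displacement_interpolation mu nu path ->
  0 < t <= 1 -> exists m c, is_radial m c rho (path t).
Proof.
move=> grho [_ mu0] rnu h /andP[t0 t1].
have t01 : 0 <= t <= 1 by rewrite ltW.
exists (affine t (affine (1 - t) o m0) m1), (t * c1).
apply: (is_radial_affine grho rnu t0) => A mA.
rewrite (displacement_dirac mu0 h t01)// /pushforward.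
by congr (nu (_ @^-1` A)); apply/funext => x; exact: lerp_cst.
Qed.

Lemma RMM_mixture (I : finType) (rho : generator R) (M : mixture R n I) :
  is_generator n rho -> identifiable n rho -> simplex (weight M) ->
  (forall i, exists m c, is_radial m c rho (component M i)) ->
  RMM (mixture_measure M).
Proof.
move=> grho irho [w0 w1] rM; exists rho; split=> //.
exists #|I|, (Mixture (weight M \o enum_val) (component M \o enum_val)).
have bij : {on [pred i : I | true], bijective (@enum_val I (mem I))}.
  exact/onW_bij/enum_val_bij.
split=> [|A mA]; last by rewrite /mixture_measure/= (reindex _ bij).
split; last by move=> k; exact: rM.
by split=> [k|]; [exact: w0|rewrite -w1 (reindex _ bij)].
Qed.

End RadialInterpolation.

Theorem theorem3p4 (R : realType) (d : nat) (hd : (0 < d)%N)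
    (rho0 rho1 : generator R) (K0 K1 : nat)
    (m0 : 'I_K0 -> d.-tuple R) (m1 : 'I_K1 -> d.-tuple R)
    (c0 : 'I_K0 -> R) (c1 : 'I_K1 -> R)
    (M0 : mixture R d 'I_K0) (M1 : mixture R d 'I_K1)
    (w : 'I_K0 -> 'I_K1 -> R)
    (nu : 'I_K0 -> 'I_K1 -> R -> probability (d.-tuple R) R)
    (hrho0 : is_generator d rho0) (hrho1 : is_generator d rho1)
    (hid0 : identifiable d rho0) (hid1 : identifiable d rho1)
    (hpi0 : simplex (weight M0)) (hpi1 : simplex (weight M1))
    (hnu0 : forall k, is_radial (m0 k) (c0 k) rho0 (component M0 k))
    (hnu1 : forall l, is_radial (m1 l) (c1 l) rho1 (component M1 l))
    (hw : optimal_plan M0 M1 w)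
    (hnu : forall k l,
       displacement_interpolation (component M0 k) (component M1 l) (nu k l)) :
  let mu (t : R) : mixture R d ('I_K0 * 'I_K1)%type :=
    Mixture (fun kl => w kl.1 kl.2) (fun kl => nu kl.1 kl.2 t) in
  [/\ same_measure (mixture_measure (mu 0)) (mixture_measure M0),
      same_measure (mixture_measure (mu 1)) (mixture_measure M1),
      forall s t : R, 0 <= s -> s <= t -> t <= 1 ->
        RW2 (mu s) (mu t) = (t - s) * RW2 M0 M1 &
      [\/ rho0 = rho1, rho0 = dirac_delta | rho1 = dirac_delta] ->
        forall t : R, 0 <= t <= 1 -> RMM (mixture_measure (mu t))].
Proof.
move=> mu; have pw := hw.1.
have f0 k := radial_second_moment hrho0 (hnu0 k).
have f1 l := radial_second_moment hrho1 (hnu1 l).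
have wmu : simplex (fun kl : 'I_K0 * 'I_K1 => w kl.1 kl.2).
  exact: simplex_plan pw hpi0.
split.
- exact: mixture_measure_start pw hnu.
- exact: mixture_measure_end pw hnu.
- by move=> s t; exact: RW2_interpolation.
have RMM_start : RMM (mixture_measure (mu 0)).
  apply: (RMM_mixture hrho0) => // kl; exists (m0 kl.1), (c0 kl.1).
  exact: is_radial_same (displacement_start (hnu _ _)) (hnu0 _).
have RMM_end : RMM (mixture_measure (mu 1)).
  apply: (RMM_mixture hrho1) => // kl; exists (m1 kl.2), (c1 kl.2).
  exact: is_radial_same (displacement_end (hnu _ _)) (hnu1 _).
move=> rho01 t t01; have [t0 t1] := andP t01.
case: rho01 => [rhoE|rhoE|rhoE].
- apply: (RMM_mixture hrho0) => // kl.
  apply: (displacement_radial hrho0 (hnu0 _) _ (hnu _ _) t01).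
  by rewrite rhoE; exact: hnu1.
(* With [rho0] the Dirac generator the mixture consists of point masses at time
   [0] and belongs to [rho1] afterwards. *)
- move: t0; rewrite le_eqVlt => /orP[/eqP <-//|t_gt0].
  apply: (RMM_mixture hrho1) => // kl.
  apply: (displacement_dirac_radial hrho1 _ (hnu1 _) (hnu _ _)); last first.
    by rewrite t_gt0.
  by rewrite -rhoE; exact: hnu0.
- move: t1; rewrite le_eqVlt => /orP[/eqP ->//|t_lt1].
  apply: (RMM_mixture hrho0) => // kl.
  rewrite -[t](subKr 1).
  apply: (displacement_dirac_radial hrho0 _ (hnu0 _)
    (displacement_interpolation_rev (hnu _ _))).
    by rewrite -rhoE; exact: hnu1.
  by rewrite subr_gt0 t_lt1 lerBlDr lerDl.
Qed.
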